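(* Let $\Gamma$ be a discrete group and let $G$ and $H$ be compact connected metrizable abelian groups. Let $\rho$ and $\sigma$ be affine actions of $\Gamma$ on $G$ and $H$ respectively such that $(H,\sigma)$ is expansive. Then every $\Gamma$-equivariant continuous map $f:(G,\rho)\to(H,\sigma)$ is an affine map.
   Context: An affine map between topological groups $X\to X'$ is a map $x\mapsto c\,\theta(x)$ with $c\in X'$ and $\theta:X\to X'$ a continuous homomorphism. An affine action of $\Gamma$ on a topological group $X$ is a continuous action $\rho$ of $\Gamma$ on $X$ such that every $\rho(\gamma)$ is an affine map. A map $f:(G,\rho)\to(H,\sigma)$ is $\Gamma$-equivariant if $f\circ\rho(\gamma)=\sigma(\gamma)\circ f$ for all $\gamma\in\Gamma$. For a topological group $X$ with an action $\rho$ of $\Gamma$, $(X,\rho)$ is expansive if there exists a neighbourhood $U$ of the identity in $X$ such that for any two distinct elements $x,y\in X$ there exists $\gamma\in\Gamma$ such that $\rho(\gamma)(x)\,\rho(\gamma)(y)^{-1}\notin U$. *)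

(* Defs.v *)
From HB Require Import structures.
From mathcomp Require Import all_boot all_order all_algebra.
From mathcomp Require Import boolp classical_sets reals topology tvs.

Set Implicit Arguments.
Unset Strict Implicit.
Unset Printing Implicit Defensive.

Import Order.TTheory GRing.Theory Num.Theory.

Local Open Scope classical_set_scope.
Local Open Scope ring_scope.

(* Multiplication and inversion need no continuity requirement: every map out
   of a discrete space is continuous. *)
#[short(type="discreteGroupType")]
HB.structure Definition DiscreteGroup :=
  {T of DiscreteTopology T & monoid.Group T}.

Definition metrizable (R : realType) (T : topologicalType) : Prop :=
  exists d : T -> T -> R,
    [/\ forall x y, 0 <= d x y,
        forall x y, d x y = 0 <-> x = y,
        forall x y, d x y = d y x,
        forall x y z, d x z <= d x y + d y z &
        forall x, nbhs x = nbhs_ball_ (fun y e => [set z | d y z < e]) x].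

(* Topological abelian groups are written additively: c * theta(x) becomes
   c + theta x and x * y^-1 becomes x - y. *)

Definition affine_map (X Y : topologicalZmodType) (f : X -> Y) : Prop :=
  exists (c : Y) (theta : {additive X -> Y}),
    continuous theta /\ forall x, f x = c + theta x.

Definition continuous_action (Gamma : discreteGroupType) (X : topologicalType)
    (rho : Gamma -> X -> X) : Prop :=
  [/\ forall x, rho 1%g x = x,
      forall g h x, rho (g * h)%g x = rho g (rho h x) &
      continuous (fun p : Gamma * X => rho p.1 p.2)].

Definition affine_action (Gamma : discreteGroupType) (X : topologicalZmodType)
    (rho : Gamma -> X -> X) : Prop :=
  continuous_action rho /\ forall g, affine_map (rho g).

Definition expansive (Gamma : Type) (X : topologicalZmodType)
    (rho : Gamma -> X -> X) : Prop :=
  exists2 U : set X, nbhs (0 : X) U &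
    forall x y, x <> y -> exists g, ~ U (rho g x - rho g y).

Definition equivariant (Gamma X Y : Type) (rho : Gamma -> X -> X)
    (sigma : Gamma -> Y -> Y) (f : X -> Y) : Prop :=
  forall g, f \o rho g = sigma g \o f.

(* Main.v *)
Require Import Defs.
From HB Require Import structures.
From mathcomp Require Import all_boot all_order all_algebra.
From mathcomp Require Import boolp classical_sets reals topology tvs.
From mathcomp Require Import normedtype trigo.
From mathcomp Require Import ring lra.

(** An equivariant map is affine as soon as all its second differences
<< f (x + y) - f x - f y + f 0 >> vanish. By equivariance, the linear part of an
element of the acting group sends a second difference of f to another one. On the
other hand, every character of H turns f into a map to the circle, and the
differences of that map along translations have continuous real angles, bounded by
compactness (difference_lift); hence so have the second differences. If a nonzero
second difference could be replaced by the element with the same angles multiplied by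
a small t, the orbit of that element would remain in a given neighbourhood of 0,
against expansiveness.
The proof in second_difference_eq0 carries out this idea.

The rescaled element exists because angles reached continuously from 0 can be cut
into small increments; a subset of the increments, chosen by the Shapley-Folkman rounding
argument (rounding), adds up to nearly t times the total, and H is compact
(fractional_lift).

The argument uses characters of H near 0, that is, that finitely many of them detect
each neighbourhood of 0 (finite_characters). They arise as follows. The mean of
a continuous function is obtained by averaging translates, which contracts oscillations
(avg_osc). For a positive definite kernel k, the positive definite functions h with
h 0 = 1 that maximise the mean of k * h are eigenfunctions of the convolution by k
(posdef_defect), and their continuity is controlled by that of k, so that maxima are
attained. Maximising in addition the mean of h * h singles out an extreme point
(extremal_exists), and extreme points satisfy d'Alembert's equation
<< h (x + a) + h (x - a) = 2 * h a * h x >> (extremal_dAlembert): such an h is the real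
part of a character (dAlembert_character). A kernel built from a function that
distinguishes z from 0 yields a character that is nontrivial at z. *)

Set Implicit Arguments.
Unset Strict Implicit.
Unset Printing Implicit Defensive.

Import Order.TTheory GRing.Theory Num.Theory.
Import numFieldNormedType.Exports.

Local Open Scope classical_set_scope.
Local Open Scope ring_scope.

(** * Two approximation principles *)

Section ArchimedeanBounds.
Variable R : realType.

Lemma eq_of_dist (a b C : R) : (forall e, 0 < e -> `|a - b| <= C * e) -> a = b.
Proof.
move=> h; apply/eqP; rewrite -subr_eq0 -normr_eq0; apply/eqP/le_anti.
rewrite normr_ge0 andbT leNgt; apply/negP => ab.
have C1 : 0 < 2 * (`|C| + 1) by rewrite mulr_gt0// ltr_wpDl.
have := h _ (divr_gt0 ab C1).
rewrite mulrA ler_pdivlMr//.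
have : C * `|a - b| <= `|C| * `|a - b| by rewrite ler_wpM2r// ler_norm.
have : 0 <= `|C| * `|a - b| by rewrite mulr_ge0.
rewrite mulrCA mulrDr mulr1 (mulrC `|a - b|); move: (`|C| * _) => *; lra.
Qed.

Lemma ge0_of_ge (a C : R) : (forall e, 0 < e -> - (C * e) <= a) -> 0 <= a.
Proof.
move=> h; rewrite leNgt; apply/negP => a0.
have C1 : 0 < 2 * (`|C| + 1) by rewrite mulr_gt0// ltr_wpDl.
have na : 0 < - a by rewrite oppr_gt0.
have := h _ (divr_gt0 na C1); rewrite mulrA mulrN mulNr opprK ler_pdivrMr//.
have : C * a >= `|C| * a by rewrite ler_wnM2r ?ler_norm// ltW.
have : `|C| * a <= 0 by rewrite mulr_ge0_le0// ltW.
rewrite mulrCA mulrDr mulr1 (mulrC a); move: (`|C| * a) => *; lra.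
Qed.

End ArchimedeanBounds.

(** * Averages over finitely many translates *)

Definition modulus (R : realType) (H : topologicalZmodType) (V : set H) (e : R)
    (f : H -> R) :=
  forall x y, V (x - y) -> `|f x - f y| <= e.

(** Uniform continuity for the translation-invariant uniformity that the topology
of the group determines. *)
Definition ucont (R : realType) (H : topologicalZmodType) (f : H -> R) :=
  forall e : R, 0 < e -> exists2 V : set H, nbhs (0 : H) V & modulus V e f.

Section Topology.
Variable H : topologicalZmodType.

Lemma nbhs_sub_left (V : set H) (w : H) :
  nbhs (0 : H) V -> \forall w' \near w, V (w - w').
Proof.
move=> V0.
have c : (fun w' : H => w - w') @ w --> w - w.
  apply: (@continuous_comp _ _ _ (fun w' => (w, w')) (fun x : H * H => x.1 - x.2)).
    by apply: cvg_pair; [exact: cvg_cst|exact: cvg_id].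
  exact: sub_continuous.
by apply: c; rewrite subrr.
Qed.

Lemma nbhs_subr (V : set H) (w : H) :
  nbhs (0 : H) V -> \forall x \near w, V (x - w).
Proof.
move=> V0.
have c : (fun x : H => x - w) @ w --> w - w.
  apply: (@continuous_comp _ _ _ (fun x => (x, w)) (fun x : H * H => x.1 - x.2)).
    by apply: cvg_pair; [exact: cvg_id|exact: cvg_cst].
  exact: sub_continuous.
by apply: c; rewrite subrr.
Qed.

(** Otherwise the sets of points far from the points of s, for s a finite
sequence, generate a proper filter, and a cluster point w of it is far from itself. *)
Lemma compact_net (Hc : compact [set: H]) (V : set H) : nbhs (0 : H) V ->
  exists s : seq H, forall w, exists2 y, y \in s & V (y - w).
Proof.
move=> V0; apply: contrapT => noS.
pose B (s : seq H) : set H := [set w | forall y, y \in s -> ~ V (y - w)].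
have Bne s : B s !=set0.
  apply: contrapT => Bs; apply: noS; exists s => w.
  apply: contrapT => h; apply: Bs; exists w => y ys Vy; apply: h.
  by exists y.
have FF : ProperFilter (filter_from [set: seq H] B).
  apply: filter_from_proper; last by move=> s _; exact: Bne.
  apply: filter_from_filter; first by exists [::].
  move=> s t _ _; exists (s ++ t) => // w Bw; split => y ys; apply: Bw.
    by rewrite mem_cat ys.
  by rewrite mem_cat ys orbT.
have [w [_ cw]] := Hc _ FF (ltac:(by exists [::])).
have [w' [Bw' Vw']] := cw (B [:: w]) _ (ltac:(by exists [:: w])) (nbhs_sub_left w V0).
by apply: (Bw' w) => //; rewrite inE.
Qed.

End Topology.

Section Average.
Variables (R : realType) (H : topologicalZmodType).
Implicit Types (f g : H -> R) (s t : seq H) (V : set H).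

Definition avg s f x : R := (\sum_(y <- s) f (x + y)) / (size s)%:R.

Lemma size_gt0R s : s != [::] -> 0 < (size s)%:R :> R.
Proof. by rewrite ltr0n; case: s. Qed.

Lemma sum_le_const s (F : H -> R) c :
  (forall y, y \in s -> F y <= c) -> \sum_(y <- s) F y <= c * (size s)%:R.
Proof.
elim: s => [|a s IH] h; first by rewrite big_nil mulr0.
rewrite big_cons /= -natr1 mulrDr mulr1 addrC lerD ?h ?inE ?eqxx//.
by apply: IH => y ys; apply: h; rewrite inE ys orbT.
Qed.

Lemma avgN s f x : avg s (fun y => - f y) x = - avg s f x.
Proof. by rewrite /avg sumrN mulNr. Qed.

Lemma avgD s f g x : avg s (fun y => f y + g y) x = avg s f x + avg s g x.
Proof. by rewrite /avg big_split mulrDl. Qed.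

Lemma avg_le s f c x : s != [::] -> (forall y, f y <= c) -> avg s f x <= c.
Proof.
move=> s0 fc; rewrite /avg ler_pdivrMr ?size_gt0R//.
by apply: sum_le_const => y _.
Qed.

Lemma avg_ge s f c x : s != [::] -> (forall y, c <= f y) -> c <= avg s f x.
Proof.
move=> s0 fc; rewrite -lerN2 -avgN; apply: avg_le => // y.
by rewrite lerN2.
Qed.

Lemma avgC s t f x : avg s (avg t f) x = avg t (avg s f) x.
Proof.
rewrite /avg -!mulr_suml exchange_big /= -!mulrA; congr (_ * _).
  by apply: eq_bigr => y _; apply: eq_bigr => z _; rewrite -!addrA (addrC y).
exact: mulrC.
Qed.

Definition sum_seq s t : seq H := [seq y + z | y <- s, z <- t].

Lemma sum_seq_neq0 s t : s != [::] -> t != [::] -> sum_seq s t != [::].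
Proof. by case: s; case: t. Qed.

Lemma avg_sum_seq s t f x : avg (sum_seq s t) f x = avg s (avg t f) x.
Proof.
rewrite /avg size_allpairs natrM invfM -mulr_suml -mulrA (mulrC (_^-1)).
rewrite big_allpairs_dep; congr (_ * _).
by apply: eq_bigr => y _; apply: eq_bigr => z _; rewrite addrA.
Qed.

Lemma avg_modulus s V e f : s != [::] -> modulus V e f -> modulus V e (avg s f).
Proof.
move=> s0 fV x y Vxy; rewrite /avg -mulrBl -sumrB.
rewrite normrM [X in _ * X]ger0_norm ?invr_ge0//.
rewrite ler_pdivrMr ?size_gt0R//; apply: le_trans (ler_norm_sum _ _ _) _.
apply: sum_le_const => z _; apply: fV.
by rewrite opprD addrACA subrr addr0.
Qed.

(** One averaging over a V-net shrinks an interval containing the values: if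
some value lies in the lower half, then every translate of the net meets the
place where it is attained, so that no average is close to the top; otherwise the
lower half of the interval can be discarded. *)
Lemma avg_contract V e f s lo b :
  (forall w, exists2 y, y \in s & V (y - w)) ->
  modulus V e f -> 0 < e -> 3 * e <= b ->
  (forall x, lo <= f x <= lo + b) ->
  exists lo', forall x, lo' <= avg s f x <= lo' + (b - e / (2 * (size s)%:R)).
Proof.
move=> net fV e0 be fb.
have s0 : s != [::] by have [y] := net 0; case: (s).
have n0 := size_gt0R s0.
have n1 : (1 : R) <= (size s)%:R by rewrite ler1n; case: (s) s0.
have cE : e / (2 * (size s)%:R) = (e / 2) / (size s)%:R by rewrite invfM mulrA.
have c1 : e / (2 * (size s)%:R) <= e / 2.
  by rewrite cE ler_pdivrMr// ler_peMr//; lra.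
have [[x0 fx0]|h] := pselect (exists x, f x <= lo + b / 2); last first.
  exists (lo + b / 2) => x; apply/andP; split.
    apply: avg_ge => // y; apply: contrapT => /negP; rewrite -ltNge => fy.
    by apply: h; exists y; exact: ltW.
  have avg_up : avg s f x <= lo + b by apply: avg_le => // y; case/andP: (fb y).
  by move: (e / _) c1 => c c1; lra.
exists lo => x; apply/andP; split.
  by apply: avg_ge => // y; case/andP: (fb y).
have [y ys Vy] := net (x0 - x).
have fxy : f (x + y) <= lo + b / 2 + e.
  have := fV (x + y) x0; rewrite (_ : x + y - x0 = y - (x0 - x)); last first.
    by rewrite opprB (addrC x) addrA.
  by move=> /(_ Vy); rewrite ler_distl => /andP[_]; lra.
rewrite /avg ler_pdivrMr// (perm_big _ (perm_to_rem ys)) big_cons /=.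
have : \sum_(j <- rem y s) f (x + j) <= (lo + b) * (size (rem y s))%:R.
  by apply: sum_le_const => z _; case/andP: (fb (x + z)).
have -> : (size (rem y s))%:R = (size s)%:R - 1 :> R.
  by rewrite size_rem// -subn1 natrB//; case: (s) s0.
rewrite cE [X in _ -> _ <= X]mulrDl mulrBl divfK; last by rewrite gt_eqF.
set n := (size s)%:R; set S := \sum_(j <- _) _; move: fxy; set F := f _ => ? ?.
nra.
Qed.

Hypothesis Hc : compact [set: H].

(** The averaging set depends on f only through V, e and B. This uniformity is
what later allows means to be computed on pointwise limits. *)
Lemma avg_osc V (e B : R) : nbhs (0 : H) V -> 0 < e ->
  exists2 s, s != [::] &
    forall f, (forall x, `|f x| <= B) -> modulus V e f ->
      forall x x', `|avg s f x - avg s f x'| <= 3 * e.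
Proof.
move=> V0 e0; have [s net] := compact_net Hc V0.
have s0 : s != [::] by have [y] := net 0; case: (s).
have n0 := size_gt0R s0.
set d := e / (2 * (size s)%:R).
have d0 : 0 < d by rewrite divr_gt0// mulr_gt0.
pose sn := fix sn n := if n is n'.+1 then sum_seq s (sn n') else [:: 0].
have sn0 n : sn n != [::] by elim: n => //= n IH; exact: sum_seq_neq0.
have key f : (forall x, `|f x| <= B) -> modulus V e f -> forall n,
    exists lo b, [/\ b <= Num.max (3 * e) (2 * B - n%:R * d) &
      forall x, lo <= avg (sn n) f x <= lo + b].
  move=> fB fV; elim=> [|n [lo [b [bn fb]]]].
    exists (- B), (2 * B); split; first by rewrite mul0r subr0 le_max lexx orbT.
    move=> x; rewrite /avg /= big_seq1 addr0 divr1.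
    by have := fB x; rewrite ler_norml => /andP[? ?]; apply/andP; split; lra.
  have [be|be] := leP (3 * e) b; last first.
    exists lo, b; split; first by rewrite le_max (ltW be).
    move=> x; rewrite /= avg_sum_seq; apply/andP; split.
      by apply: avg_ge => // y; case/andP: (fb y).
    by apply: avg_le => // y; case/andP: (fb y).
  have [lo' h] := avg_contract net (avg_modulus (sn0 n) fV) e0 be fb.
  exists lo', (b - d); split; last by move=> x; rewrite /= avg_sum_seq; exact: h.
  move: bn; rewrite !le_max => /orP[bn|bn]; apply/orP.
    by left; lra.
  by right; rewrite -natr1 mulrDl mul1r; lra.
(* every step gains d until the width is at most 3 * e, and the width starts at 2 * B *)
have [n nB] : exists n : nat, 2 * B / d < n%:R.
  exists (Num.bound `|2 * B / d|); apply: le_lt_trans (ler_norm _) _.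
  exact: archi_boundP (normr_ge0 _).
exists (sn n) => // f fB fV x x'.
have [lo [b [bn fb]]] := key f fB fV n.
have b3 : b <= 3 * e.
  move: bn; rewrite le_max => /orP[//|bn].
  by move: nB; rewrite ltr_pdivrMr// => nB; lra.
have /andP[? ?] := fb x; have /andP[? ?] := fb x'.
by rewrite ler_norml; apply/andP; split; lra.
Qed.

(** For f continuous on a compact group this is the integral of f for the Haar
probability measure: averages of translates have the same integral as f and can be
made almost constant. *)
Definition mean f : R :=
  sup [set a | exists2 s, s != [::] & forall x, a <= avg s f x].

(** Averages commute, so a constant below some average of f is also below an
average of avg s f, which varies by at most e. *)
Lemma mean_avg s f e (B : R) : s != [::] -> (forall x, `|f x| <= B) ->
  (forall x x', `|avg s f x - avg s f x'| <= e) ->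
  forall x, `|avg s f x - mean f| <= e.
Proof.
move=> s0 fB osc x.
set S := [set a | exists2 s, s != [::] & forall x, a <= avg s f x].
have ub : ubound S (avg s f x + e).
  move=> a [t t0 ta].
  have : a <= avg s (avg t f) 0 by exact: avg_ge.
  rewrite avgC => /le_trans; apply; apply: avg_le => // y.
  by have := osc y x; rewrite ler_distl => /andP[_]; lra.
have low : S (avg s f x - e).
  exists s => // y.
  by have := osc x y; rewrite ler_distl => /andP[_]; lra.
rewrite ler_distl; apply/andP; split.
  have : mean f <= avg s f x + e.
    by apply: ge_sup => //; exists (avg s f x - e).
  by lra.
have : avg s f x - e <= mean f.
  by apply: ub_le_sup => //; exists (avg s f x + e).
by lra.
Qed.

End Average.

(** * The Haar mean of a uniformly continuous function *)

Section Uniform.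
Variables (R : realType) (H : topologicalZmodType).
Implicit Types (f g : H -> R).

Lemma modulusW (V W : set H) (e e' : R) f :
  W `<=` V -> e <= e' -> modulus V e f -> modulus W e' f.
Proof. by move=> WV ee fV x y /WV/fV/le_trans; apply. Qed.

Lemma modulusM V (e1 e2 B1 B2 : R) f g :
  (forall x, `|f x| <= B1) -> (forall x, `|g x| <= B2) ->
  modulus V e1 f -> modulus V e2 g ->
  modulus V (B1 * e2 + B2 * e1) (fun x => f x * g x).
Proof.
move=> fB gB fV gV x y Vxy.
have -> : f x * g x - f y * g y = f x * (g x - g y) + g y * (f x - f y) by ring.
apply: le_trans (ler_normD _ _) _; rewrite !normrM.
by apply: lerD; apply: ler_pM => //; [exact: gV|exact: fV].
Qed.

Lemma ucont_cst (a : R) : ucont (fun _ : H => a).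
Proof. by move=> e e0; exists setT; [exact: filterT|move=> x y _; rewrite subrr normr0 ltW]. Qed.

Lemma ucontD f g : ucont f -> ucont g -> ucont (fun x => f x + g x).
Proof.
move=> fu gu e e0; have e2 : 0 < e / 2 by rewrite divr_gt0.
have [V V0 fV] := fu _ e2; have [W W0 gW] := gu _ e2.
exists (V `&` W); first exact: filterI.
move=> x y [/fV fxy /gW gxy]; rewrite opprD addrACA.
by apply: le_trans (ler_normD _ _) _; lra.
Qed.

Lemma ucontZ a f : ucont f -> ucont (fun x => a * f x).
Proof.
move=> fu e e0; have a0 : 0 < `|a| + 1 by rewrite ltr_wpDl.
have [V V0 fV] := fu _ (divr_gt0 e0 a0); exists V => // x y /fV fxy.
rewrite -mulrBr normrM.
have : (`|a| + 1) * `|f x - f y| <= e by rewrite mulrC -ler_pdivlMr.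
apply: le_trans; rewrite ler_wpM2r//; lra.
Qed.

Lemma ucontN f : ucont f -> ucont (fun x => - f x).
Proof.
move=> /(ucontZ (-1)) h; rewrite (_ : (fun _ => _) = fun x => -1 * f x)//.
by apply/funext => x; rewrite mulN1r.
Qed.

Lemma ucontB f g : ucont f -> ucont g -> ucont (fun x => f x - g x).
Proof. by move=> fu /ucontN; exact: ucontD. Qed.

Lemma ucont_shift f a : ucont f -> ucont (fun x => f (x + a)).
Proof.
move=> fu e e0; have [V V0 fV] := fu _ e0; exists V => // x y Vxy.
by apply: fV; rewrite opprD addrACA subrr addr0.
Qed.

Lemma ucont_continuous f : ucont f -> continuous f.
Proof.
move=> fu x; apply/cvgrPdist_le => e e0; have [V V0 fV] := fu e e0.
near=> y; rewrite distrC; apply: fV.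
by near: y; exact: nbhs_subr.
Unshelve. all: by end_near. Qed.

Hypothesis Hc : compact [set: H].

(** Heine-Cantor for the uniformity of the group. *)
Lemma continuous_ucont f : continuous f -> ucont f.
Proof.
move=> fc e e0.
pose P (v x : H) := `|f (x + v) - f x| <= e.
have : \forall v \near (0 : H), [set: H] `<=` P v.
  apply: (iffLR (compact_near_coveringP _) Hc _ _ P) => x _.
  have e2 : 0 < e / 2 by rewrite divr_gt0.
  have c1 : \forall z \near x, `|f x - f z| <= e / 2.
    by have /cvgrPdist_le/(_ _ e2) := fc x.
  have c2 : \forall p \near ((x, 0) : H * H), `|f x - f (p.1 + p.2)| <= e / 2.
    have c : (fun p : H * H => p.1 + p.2) @ (x, 0 : H) --> x + 0.
      exact: (@add_continuous H (x, 0)).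
    by apply: (c [set z | `|f x - f z| <= e / 2]); rewrite addr0.
  have c3 : \forall p \near ((x, 0) : H * H), `|f x - f p.1| <= e / 2.
    exact: (@cvg_fst _ _ (nbhs x) (nbhs (0 : H)) _ _ c1).
  apply: (@filterS _ (filter_prod (nbhs x) (nbhs (0 : H))) _ _ _ _ (filterI c2 c3)).
  move=> [a b] /= [h1 h2].
  have := ler_distD (f x) (f (a + b)) (f a); rewrite (distrC (f (a + b)) (f x)).
  by move=> /le_trans; apply; lra.
move=> cover; exists [set v | forall x, P v x].
  by apply: filterS cover => v h x; exact: h.
by move=> x y /(_ y); rewrite /P (addrC y) subrK.
Qed.

Lemma ucont_bounded f : ucont f -> exists2 B : R, 0 < B & forall x, `|f x| <= B.
Proof.
move=> fu; have [V V0 fV] := fu 1 ltr01; have [s net] := compact_net Hc V0.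
exists (1 + \sum_(y <- s) `|f y|).
  by rewrite ltr_wpDr// sumr_ge0.
move=> x; have [y ys /fV fyx] := net x.
have : `|f y| <= \sum_(y <- s) `|f y|.
  by rewrite (perm_big _ (perm_to_rem ys)) big_cons lerDl sumr_ge0.
have := ler_distD 0 (f x) (f y).
have := lerB_dist (f x) (f y); rewrite (distrC (f x)) => *; lra.
Qed.

Lemma ucontM f g : ucont f -> ucont g -> ucont (fun x => f x * g x).
Proof.
move=> fu gu e e0.
have [B B0 fB] := ucont_bounded fu; have [C C0 gC] := ucont_bounded gu.
have d0 : 0 < e / (B + C) by rewrite divr_gt0// addr_gt0.
have [V V0 fV] := fu _ d0; have [W W0 gW] := gu _ d0.
exists (V `&` W); first exact: filterI.
have -> : e = B * (e / (B + C)) + C * (e / (B + C)).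
  by rewrite -mulrDl mulrC divfK// gt_eqF// addr_gt0.
by apply: modulusM fB gC _ _; [apply: modulusW fV|apply: modulusW gW] => // x [].
Qed.

End Uniform.

Section Mean.
Variables (R : realType) (H : topologicalZmodType).
Hypothesis Hc : compact [set: H].
Implicit Types (f g : H -> R).

Lemma mean_approx (V : set H) (e B : R) : nbhs (0 : H) V -> 0 < e ->
  exists2 s, s != [::] &
    forall f, (forall x, `|f x| <= B) -> modulus V e f ->
      forall x, `|avg s f x - mean f| <= 3 * e.
Proof.
move=> V0 e0; have [s s0 h] := avg_osc Hc B V0 e0.
exists s => // f fB fV; exact: (mean_avg s0 fB (h f fB fV)).
Qed.

(** A common averaging set for three functions is what makes the mean linear. *)
Lemma mean_approx3 (f g h : H -> R) e : ucont f -> ucont g -> ucont h -> 0 < e ->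
  exists s, [/\ s != [::], forall x, `|avg s f x - mean f| <= e,
    forall x, `|avg s g x - mean g| <= e & forall x, `|avg s h x - mean h| <= e].
Proof.
move=> fu gu hu e0; have e3 : 0 < e / 3 by rewrite divr_gt0.
have [B1 _ fB] := ucont_bounded Hc fu; have [B2 _ gB] := ucont_bounded Hc gu.
have [B3 _ hB] := ucont_bounded Hc hu.
have [V1 V10 fV] := fu _ e3; have [V2 V20 gV] := gu _ e3; have [V3 V30 hV] := hu _ e3.
pose V := V1 `&` V2 `&` V3.
have V0 : nbhs (0 : H) V by do 2?apply: filterI.
have [s s0 hs] := mean_approx (Num.max B1 (Num.max B2 B3)) V0 e3.
have -> : e = 3 * (e / 3) by rewrite mulrC divfK// pnatr_eq0.
exists s; split=> //; apply: hs.
- by move=> x; rewrite le_max fB.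
- by apply: modulusW fV => // x [[]].
- by move=> x; rewrite !le_max gB orbT.
- by apply: modulusW gV => // x [[]].
- by move=> x; rewrite !le_max hB !orbT.
- by apply: modulusW hV => // x [[]].
Qed.

Lemma meanD f g : ucont f -> ucont g -> mean (fun x => f x + g x) = mean f + mean g.
Proof.
move=> fu gu; apply: (@eq_of_dist _ _ _ 3) => e e0.
have [s [s0 /(_ 0)]] := mean_approx3 fu gu (ucontD fu gu) e0.
rewrite !ler_distl => h1 /(_ 0) + /(_ 0).
rewrite !ler_distl avgD => h2 h3.
by move: h1 h2 h3 => /andP[? ?] /andP[? ?] /andP[? ?]; apply/andP; split; lra.
Qed.

Lemma meanZ a f : ucont f -> mean (fun x => a * f x) = a * mean f.
Proof.
move=> fu; apply: (@eq_of_dist _ _ _ (1 + `|a|)) => e e0.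
have [s [s0 /(_ 0) h1 /(_ 0) h2 _]] := mean_approx3 fu (ucontZ a fu) fu e0.
have E : avg s (fun x => a * f x) 0 = a * avg s f 0.
  by rewrite /avg -mulr_sumr mulrA.
rewrite E distrC in h2.
apply: le_trans (ler_distD (a * avg s f 0) _ _) _.
rewrite mulrDl mul1r lerD//.
by rewrite -mulrBr normrM ler_wpM2l.
Qed.

Lemma meanN f : ucont f -> mean (fun x => - f x) = - mean f.
Proof.
move=> fu; rewrite -mulN1r -meanZ//; congr mean.
by apply/funext => x; rewrite mulN1r.
Qed.

Lemma meanB f g : ucont f -> ucont g -> mean (fun x => f x - g x) = mean f - mean g.
Proof. by move=> fu gu; rewrite meanD ?meanN//; exact: ucontN. Qed.

Lemma mean_shift f a : ucont f -> mean (fun x => f (x + a)) = mean f.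
Proof.
move=> fu; apply: (@eq_of_dist _ _ _ 2) => e e0.
have [s [s0 /(_ a) h1 /(_ 0) h2 _]] := mean_approx3 fu (ucont_shift a fu) fu e0.
have E : avg s (fun x => f (x + a)) 0 = avg s f a.
  by rewrite /avg; congr (_ / _); apply: eq_bigr => y _; rewrite add0r addrC.
rewrite E distrC in h2.
by apply: le_trans (ler_distD (avg s f a) _ _) _; lra.
Qed.

Lemma mean_le_cst f a : ucont f -> (forall x, f x <= a) -> mean f <= a.
Proof.
move=> fu fa; rewrite leNgt; apply/negP => am.
have e0 : 0 < (mean f - a) / 2 by rewrite divr_gt0// subr_gt0.
have [s [s0 /(_ 0) h1 _ _]] := mean_approx3 fu fu fu e0.
have := avg_le 0 s0 fa; move: h1; rewrite ler_distl => /andP[]; lra.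
Qed.

Lemma mean_ge_cst f a : ucont f -> (forall x, a <= f x) -> a <= mean f.
Proof.
move=> fu fa; rewrite -lerN2 -meanN//; apply: mean_le_cst; first exact: ucontN.
by move=> x; rewrite lerN2.
Qed.

Lemma ucont_sum (I : Type) (r : seq I) (F : I -> H -> R) :
  (forall i, ucont (F i)) -> ucont (fun x => \sum_(i <- r) F i x).
Proof.
move=> Fu; elim: r => [|i r IH].
  have := @ucont_cst R H 0.
  by congr ucont; apply/funext => x; rewrite big_nil.
have := ucontD (Fu i) IH.
by congr ucont; apply/funext => x; rewrite big_cons.
Qed.

Lemma mean_cst (a : R) : mean (fun _ : H => a) = a.
Proof.
by apply/le_anti/andP; split; [apply: mean_le_cst|apply: mean_ge_cst];
  rewrite //; exact: ucont_cst.
Qed.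

Lemma mean_sum (I : Type) (r : seq I) (F : I -> H -> R) :
  (forall i, ucont (F i)) ->
  mean (fun x => \sum_(i <- r) F i x) = \sum_(i <- r) mean (F i).
Proof.
move=> Fu; elim: r => [|i r IH].
  rewrite big_nil -[RHS]mean_cst; congr mean.
  by apply/funext => x; rewrite big_nil.
rewrite big_cons -IH -meanD//; last exact: ucont_sum.
by congr mean; apply/funext => x; rewrite big_cons.
Qed.

Lemma mean_norm f a : ucont f -> (forall x, `|f x| <= a) -> `|mean f| <= a.
Proof.
move=> fu fa; rewrite ler_norml mean_ge_cst ?mean_le_cst// => x.
  by have := fa x; rewrite ler_norml => /andP[].
by have := fa x; rewrite ler_norml => /andP[].
Qed.

(** Finitely many translates of the place where f exceeds half of its value at
x0 cover the group, so some average of f is bounded below by a positive constant. *)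
Lemma mean_gt0 f x0 : ucont f -> (forall x, 0 <= f x) -> 0 < f x0 -> 0 < mean f.
Proof.
move=> fu f0 fx0; have e0 : 0 < f x0 / 2 by rewrite divr_gt0.
have [V V0 fV] := fu _ e0; have [s net] := compact_net Hc V0.
have s0 : s != [::] by have [y] := net 0; case: (s).
have n0 := @size_gt0R R _ _ s0.
have [B B0 fB] := ucont_bounded Hc fu.
apply: lt_le_trans (_ : f x0 / 2 / (size s)%:R <= _); first by rewrite divr_gt0.
have low x : f x0 / 2 / (size s)%:R <= avg s f x.
  rewrite /avg ler_pM2r ?invr_gt0//.
  have [y ys Vy] := net (x0 - x).
  have fxy := fV (x + y) x0; rewrite (_ : x + y - x0 = y - (x0 - x)) in fxy; last first.
    by rewrite opprB (addrC x) addrA.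
  have := fxy Vy; rewrite ler_distl => /andP[h _].
  rewrite (perm_big _ (perm_to_rem ys)) big_cons.
  apply: (@le_trans _ _ (f (x + y))); last by rewrite lerDl sumr_ge0.
  by lra.
apply: ub_le_sup; last by exists s.
exists B => a [t t0 ta]; apply: le_trans (ta 0) _.
by apply: avg_le => // y; apply: le_trans (ler_norm _) (fB y).
Qed.

End Mean.

Section Reflection.
Variables (R : realType) (H : topologicalZmodType).
Implicit Types (f g h : H -> R).

Lemma ucont_opp f : ucont f -> ucont (fun x => f (- x)).
Proof.
move=> fu e e0; have [V V0 fV] := fu e e0.
exists [set v | V (- v)].
  by apply: (@opp_continuous H 0 V); rewrite oppr0.
by move=> x y /= Vxy; apply: fV; rewrite -opprD.
Qed.

Hypothesis Hc : compact [set: H].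

(** The opposites of an averaging set for f form an averaging set for the
reflection of f, and two averagings of the same function commute. *)
Lemma mean_opp f : ucont f -> mean (fun x => f (- x)) = mean f.
Proof.
move=> fu; have gu := ucont_opp fu; apply: (@eq_of_dist _ _ _ 2) => e e0.
have [s [s0 hf _ _]] := mean_approx3 Hc fu fu fu e0.
have [t [t0 hg _ _]] := mean_approx3 Hc gu gu gu e0.
pose s' := [seq - y | y <- s].
have s'0 : s' != [::] by rewrite /s'; case: (s) s0.
have E x : avg s' (fun x => f (- x)) x = avg s f (- x).
  rewrite /avg size_map big_map; congr (_ / _); apply: eq_bigr => y _.
  by rewrite opprD opprK.
set g := fun x => f (- x).
have : avg t (avg s' g) 0 <= mean f + e.
  by apply: avg_le => // y; rewrite E; have := hf (- y); rewrite ler_distl => /andP[].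
have : mean f - e <= avg t (avg s' g) 0.
  by apply: avg_ge => // y; rewrite E; have := hf (- y); rewrite ler_distl => /andP[].
rewrite avgC.
have : avg s' (avg t g) 0 <= mean g + e.
  by apply: avg_le => // y; have := hg y; rewrite ler_distl => /andP[].
have : mean g - e <= avg s' (avg t g) 0.
  by apply: avg_ge => // y; have := hg y; rewrite ler_distl => /andP[].
by rewrite ler_distl => *; apply/andP; split; lra.
Qed.

End Reflection.

(** * Positive definite functions *)

Section PositiveDefinite.
Variables (R : realType) (H : topologicalZmodType).
Implicit Types (f g h : H -> R) (l m : seq (R * H)).

(** For a finitely supported signed measure mu, encoded by its list l of weighted
points, this is the convolution of h with mu and the reflection of mu; its value
at 0 is the quadratic form of the kernel h (u - v) at mu. *)
Definition qshift h l (x : H) : R :=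
  \sum_(p <- l) \sum_(q <- l) p.1 * q.1 * h (x + (p.2 - q.2)).

Definition posdef h :=
  (forall x, h (- x) = h x) /\ forall l, 0 <= qshift h l 0.

Lemma posdef_ge0 h : posdef h -> 0 <= h 0.
Proof.
move=> [_ /(_ [:: (1, 0)])]; rewrite /qshift !big_seq1 /=.
by rewrite !mul1r subrr addr0.
Qed.

(** For c = 1 and c = -1 these functions have sum 4 * h, which decomposes h in the cone
of positive definite functions. *)
Lemma qshift_pair h a (c : R) x :
  qshift h [:: (1, 0); (c, a)] x = (1 + c ^+ 2) * h x + c * (h (x + a) + h (x - a)).
Proof.
rewrite /qshift !big_cons !big_nil /= !subrr subr0 sub0r !addr0; ring.
Qed.

Lemma posdef_bound h x : posdef h -> `|h x| <= h 0.
Proof.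
move=> [hN hp]; rewrite ler_norml.
have := hp [:: (1, 0); (1, x)]; have := hp [:: (1, 0); (-1, x)].
rewrite !qshift_pair !add0r hN => *; apply/andP; split; lra.
Qed.

Lemma qshift_qshift h l m x :
  qshift (qshift h l) m x =
  qshift h [seq (p.1 * q.1, p.2 + q.2) | p <- m, q <- l] x.
Proof.
rewrite /qshift big_allpairs_dep /=; apply: eq_bigr => p _.
under eq_bigr do rewrite mulr_sumr; rewrite exchange_big /=.
apply: eq_bigr => q _.
rewrite big_allpairs_dep /=; apply: eq_bigr => p' _.
rewrite mulr_sumr; apply: eq_bigr => q' _.
rewrite mulrA; congr (_ * h _); first by ring.
by rewrite opprD [p.2 + q.2 + _]addrACA -[LHS]addrA.
Qed.

Lemma posdef_qshift h l : posdef h -> posdef (qshift h l).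
Proof.
move=> [hN hp]; split; last by move=> m; rewrite qshift_qshift.
move=> x; rewrite /qshift exchange_big /=.
apply: eq_bigr => p _; apply: eq_bigr => q _.
by rewrite (mulrC q.1) -hN opprD opprK opprB.
Qed.

Lemma qshiftZ h (a : R) l x : qshift (fun y => a * h y) l x = a * qshift h l x.
Proof.
rewrite /qshift mulr_sumr; apply: eq_bigr => p _; rewrite mulr_sumr.
by apply: eq_bigr => q _; rewrite mulrCA.
Qed.

Lemma posdefZ h (a : R) : 0 <= a -> posdef h -> posdef (fun x => a * h x).
Proof.
move=> a0 [hN hp]; split=> [x|l]; first by rewrite hN.
by rewrite qshiftZ mulr_ge0.
Qed.

Lemma ucont_qshift h l : ucont h -> ucont (qshift h l).
Proof.
move=> hu; apply: ucont_sum => p; apply: ucont_sum => q.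
by apply: ucontZ; apply: ucont_shift.
Qed.

Hypothesis Hc : compact [set: H].

Definition autocorr f (x : H) : R := mean (fun w => f w * f (w + x)).

Lemma ucont_autocorr f : ucont f -> ucont (autocorr f).
Proof.
move=> fu e e0; have [B B0 fB] := ucont_bounded Hc fu.
have [V V0 fV] := fu _ (divr_gt0 e0 B0); exists V => // x y Vxy.
have u z : ucont (fun w => f w * f (w + z)).
  by apply: ucontM => //; apply: ucont_shift.
rewrite /autocorr -meanB//.
apply: mean_norm => //; first exact: ucontB.
move=> w; rewrite -mulrBr normrM -(divfK (lt0r_neq0 B0) e) mulrC.
apply: ler_pM => //; apply: fV.
by rewrite opprD addrACA subrr add0r.
Qed.

(** After translating the integration variable, the quadratic form becomes the
mean of a square. *)
Lemma posdef_autocorr f : ucont f -> posdef (autocorr f).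
Proof.
move=> fu; have u z : ucont (fun w => f w * f (w + z)).
  by apply: ucontM => //; apply: ucont_shift.
split=> [x|l].
  rewrite /autocorr -(mean_shift Hc x)//; congr mean; apply/funext => w.
  by rewrite addrK mulrC.
have E p q : autocorr f (p - q) = mean (fun w => f (w + q) * f (w + p)).
  rewrite /autocorr -(mean_shift Hc q)//; congr mean; apply/funext => w.
  by rewrite -addrA (addrC q) subrK.
have -> : qshift (autocorr f) l 0 = mean (fun w => (\sum_(p <- l) p.1 * f (w + p.2)) ^+ 2).
  rewrite /qshift.
  have v p q : ucont (fun w => f (w + q) * f (w + p)).
    by apply: ucontM => //; apply: ucont_shift.
  under eq_bigr do under eq_bigr do rewrite add0r E -meanZ//.
  under eq_bigr do (rewrite -mean_sum//; last (by move=> i; apply: ucontZ)).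
  rewrite -mean_sum//; last by move=> p; apply: ucont_sum => q; apply: ucontZ.
  congr mean; apply/funext => w.
  rewrite expr2 mulr_suml; apply: eq_bigr => p _.
  rewrite mulr_sumr; apply: eq_bigr => q _; ring.
apply: mean_ge_cst => //; last by move=> w; exact: sqr_ge0.
have : ucont (fun w => \sum_(p <- l) p.1 * f (w + p.2)).
  by apply: ucont_sum => p; apply: ucontZ; apply: ucont_shift.
by move=> v; apply: (ucontM Hc v v).
Qed.

End PositiveDefinite.

(** * Eigenfunctions of the convolution by a positive definite function *)

Section Cluster.
Variables (R : realType) (X : eqType).

(** Tychonoff's theorem in the cube of functions with values in [-1, 1]. *)
Lemma pointwise_cluster (A : R -> set (X -> R)) :
  (forall e, 0 < e -> A e !=set0) ->
  (forall e e', e <= e' -> A e `<=` A e') ->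
  (forall e f x, A e f -> `|f x| <= 1) ->
  exists f, forall e (s : seq X), 0 < e ->
    exists2 g, A e g & forall x, x \in s -> `|f x - g x| <= e.
Proof.
move=> Ane Amon Abd.
pose T := prod_topology (fun _ : X => R : topologicalType).
have cpt : compact [set f : T | forall x, `[-1, 1]%classic (f x)].
  apply: (@tychonoff X (fun=> R : topologicalType) (fun=> `[-1, 1]%classic)) => x.
  exact: segment_compact.
pose F : set_system T := filter_from [set e : R | 0 < e] A.
have FF : ProperFilter F.
  apply: filter_from_proper; last by move=> e /Ane.
  apply: filter_from_filter; first by exists 1 => /=.
  move=> e e' /= e0 e'0; exists (Num.min e e'); first by rewrite /= lt_min e0.
  by move=> f Af; split; apply: Amon Af; rewrite ge_min lexx ?orbT.
have FB : F [set f : T | forall x, `[-1, 1]%classic (f x)].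
  exists 1 => //= f Af x /=; rewrite in_itv /= -ler_norml; exact: Abd Af.
have [f [_ cf]] := cpt F FF FB.
exists f => e s e0.
have nb : nbhs (f : T) [set g : T | forall x, x \in s -> `|f x - g x| <= e].
  elim: s => [|y s IH]; first by apply: filterS filterT.
  have hy : nbhs (f : T) [set g : T | `|f y - g y| <= e].
    have hr : \forall r \near f y, `|f y - r| <= e.
      have /cvgrPdist_le : id @ f y --> f y by exact: cvg_id.
      exact.
    exact: (@proj_continuous X (fun=> R : topologicalType) y f _ hr).
  apply: filterS (filterI hy IH) => g [gy gs] x.
  by rewrite inE => /orP[/eqP ->|/gs].
have [g [Ag gs]] := cf (A e) _ (ltac:(by exists e)) nb.
by exists g.
Qed.

End Cluster.

Section Spectral.
Variables (R : realType) (H : topologicalZmodType).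
Hypothesis Hc : compact [set: H].
Implicit Types (f g h : H -> R).

Lemma mean_close (V : set H) (e B : R) : nbhs (0 : H) V -> 0 < e ->
  exists s : seq H, forall f g,
    (forall x, `|f x| <= B) -> (forall x, `|g x| <= B) ->
    modulus V e f -> modulus V e g ->
    (forall x, x \in s -> `|f x - g x| <= e) -> `|mean f - mean g| <= 7 * e.
Proof.
move=> V0 e0; have [s s0 hs] := mean_approx Hc B V0 e0.
exists s => f g fB gB fV gV fg.
have := hs f fB fV 0; have := hs g gB gV 0; rewrite !ler_distl.
have : `|avg s f 0 - avg s g 0| <= e.
  rewrite /avg -mulrBl -sumrB normrM [X in _ * X]ger0_norm ?invr_ge0//.
  rewrite ler_pdivrMr ?size_gt0R//; apply: le_trans (ler_norm_sum _ _ _) _.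
  by apply: sum_le_const => y ys; rewrite add0r; exact: fg.
rewrite ler_distl => /andP[? ?] /andP[? ?] /andP[? ?].
by apply/andP; split; lra.
Qed.

(** These play the role of the probability measures on the dual group: they are
the Fourier transforms of the symmetric ones, and the extreme points among them are
the real parts of characters. *)
Definition pdstate h := [/\ ucont h, posdef h & h 0 = 1].

Lemma pdstate_bound h x : pdstate h -> `|h x| <= 1.
Proof. by move=> [_ hp <-]; exact: posdef_bound. Qed.

Variable k : H -> R.
Hypotheses (k_ucont : ucont k) (k_posdef : posdef k) (k0_gt0 : 0 < k 0).

(** The largest eigenvalue of the convolution by k, in variational form. Since
k is a sum of characters, it is the largest of the Fourier coefficients of k. *)
Definition topval : R := sup [set a | exists2 h, pdstate h & a = mean (fun y => k y * h y)].

Definition conv h (x : H) : R := mean (fun y => k y * h (y + x)).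

Let kh_ucont h : ucont h -> ucont (fun y => k y * h y).
Proof. exact: ucontM. Qed.

Lemma topval_ub h : pdstate h -> mean (fun y => k y * h y) <= topval.
Proof.
move=> ph; apply: ub_le_sup; last by exists h.
have [B B0 kB] := ucont_bounded Hc k_ucont.
exists B => _ [g pg ->]; case: (pg) => gu _ _.
apply: (mean_le_cst Hc (kh_ucont gu)) => y.
apply: le_trans (ler_norm _) _; rewrite normrM -[B]mulr1.
by apply: ler_pM => //; exact: pdstate_bound.
Qed.

Lemma topval_posdef h : ucont h -> posdef h ->
  mean (fun y => k y * h y) <= topval * h 0.
Proof.
move=> hu hp; have := posdef_ge0 hp; rewrite le_eqVlt => /predU1P[h0|h0].
  have E : (fun y => k y * h y) = fun=> 0.
    apply/funext => y; have := posdef_bound y hp.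
    by rewrite -h0 normr_le0 => /eqP ->; rewrite mulr0.
  by rewrite E -h0 mulr0 mean_cst.
have h0' : 0 <= (h 0)^-1 by rewrite invr_ge0 ltW.
have := @topval_ub (fun x => (h 0)^-1 * h x); rewrite -ler_pdivrMr// => le.
have {le} := le (ltac:(split; [exact: ucontZ|exact: posdefZ|exact: (mulVf (lt0r_neq0 h0))])).
apply: le_trans; rewrite mulrC -meanZ//; last exact: kh_ucont.
rewrite [leLHS](_ : _ = mean (fun y => k y * ((h 0)^-1 * h y)))//.
by congr mean; apply/funext => y; exact: mulrCA.
Qed.

Lemma topval_gt0 : 0 < topval.
Proof.
have := topval_posdef k_ucont k_posdef; have : 0 < mean (fun y => k y * k y).
  apply: (@mean_gt0 _ _ Hc _ 0); first exact: kh_ucont.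
    by move=> x; rewrite -expr2 sqr_ge0.
  by rewrite mulr_gt0.
by move=> m0 /(lt_le_trans m0); rewrite pmulr_lgt0.
Qed.

(** Applying the definition of the supremum to the positive definite functions
qshift h l turns the scalar inequality into positive definiteness. *)
Lemma posdef_defect h : ucont h -> posdef h ->
  posdef (fun x => topval * h x - conv h x).
Proof.
move=> hu hp.
have u x : ucont (fun y => k y * h (y + x)).
  by apply: ucontM => //; exact: ucont_shift.
split=> [x|l].
  case: hp => hN _; rewrite hN; congr (_ - _).
  rewrite /conv -(mean_opp Hc (u _)); congr mean; apply/funext => y.
  by case: k_posdef => -> _; rewrite -opprD hN.
have -> : qshift (fun x => topval * h x - conv h x) l 0 =
    topval * qshift h l 0 - mean (fun y => k y * qshift h l y).
  rewrite -qshiftZ /qshift.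
  have -> : mean (fun y => k y * \sum_(p <- l) \sum_(q <- l)
      p.1 * q.1 * h (y + (p.2 - q.2))) =
      \sum_(p <- l) \sum_(q <- l) p.1 * q.1 * conv h (0 + (p.2 - q.2)).
    under eq_bigr do under eq_bigr do rewrite add0r -meanZ//.
    under eq_bigr do (rewrite -mean_sum//; last (by move=> i; apply: ucontZ)).
    rewrite -mean_sum//; last by move=> p; apply: ucont_sum => q; apply: ucontZ.
    congr mean; apply/funext => y; rewrite mulr_sumr; apply: eq_bigr => p _.
    by rewrite mulr_sumr; apply: eq_bigr => q _; rewrite mulrCA.
  rewrite -sumrB; apply: eq_bigr => p _; rewrite -sumrB; apply: eq_bigr => q _.
  by rewrite mulrBr.
rewrite subr_ge0; apply: topval_posdef; first exact: ucont_qshift.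
exact: posdef_qshift.
Qed.

Lemma conv_modulus h V e : pdstate h -> modulus V e k -> modulus V e (conv h).
Proof.
move=> ph kV x y Vxy; case: (ph) => hu hp _.
have E z : conv h z = mean (fun w => k (z - w) * h w).
  rewrite /conv -[RHS](mean_shift Hc z)//.
    congr mean; apply/funext => w; congr (_ * _).
    by case: k_posdef => <- _; rewrite opprD addrCA subrr addr0.
  apply: ucontM => //; have := ucont_shift (- z) k_ucont; congr ucont.
  by apply/funext => w; case: k_posdef => <- _; rewrite opprB.
have u z : ucont (fun w => k (z - w) * h w).
  apply: ucontM => //; have := ucont_shift (- z) k_ucont; congr ucont.
  by apply/funext => w; case: k_posdef => <- _; rewrite opprB.
rewrite !E -meanB//; apply: mean_norm => //; first exact: ucontB.
move=> w; rewrite -mulrBl normrM -[e]mulr1.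
apply: ler_pM => //; last exact: pdstate_bound.
by apply: kV; rewrite opprB addrA subrK.
Qed.

Definition near_top (e : R) h :=
  pdstate h /\ topval - e <= mean (fun y => k y * h y).

(** The defect topval * h - conv h is positive definite, hence bounded by its value
at 0: an almost maximal h is uniformly almost an eigenfunction. *)
Lemma near_top_defect e h x : near_top e h -> `|topval * h x - conv h x| <= e.
Proof.
move=> [[hu hp h0] he]; apply: le_trans (posdef_bound x (posdef_defect hu hp)) _.
rewrite h0 mulr1 /conv; under [X in mean X]funext do rewrite addr0.
lra.
Qed.

(** Almost eigenfunctions inherit the modulus of continuity of conv h, which is
that of k. So the maximising functions are almost equicontinuous. *)
Lemma near_top_modulus e e' V h : near_top e h -> modulus V e' k ->
  modulus V ((2 * e + e') / topval) h.
Proof.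
move=> th kV x y Vxy; have l0 := topval_gt0.
rewrite ler_pdivlMr// mulrC -[X in X * _]gtr0_norm// -normrM mulrBr.
have := near_top_defect x th; have := near_top_defect y th.
have := conv_modulus th.1 kV Vxy.
rewrite !ler_distl => /andP[? ?] /andP[? ?] /andP[? ?].
by apply/andP; split; lra.
Qed.

(** Almost equicontinuity makes one finite averaging set valid for f and all the
functions approaching it, so the means pass to the pointwise limit. *)
Lemma cluster_near_top (A : R -> set (H -> R)) f :
  (forall e, A e `<=` near_top e) ->
  (forall e (s : seq H), 0 < e ->
    exists2 g, A e g & forall x, x \in s -> `|f x - g x| <= e) ->
  near_top 0 f /\
  exists C, forall e, 0 < e ->
    exists2 g, A e g & `|mean (fun x => f x * f x) - mean (fun x => g x * g x)| <= C * e.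
Proof.
move=> Atop fA; have l0 := topval_gt0.
have fmod V e : modulus V e k -> modulus V (e / topval) f.
  move=> kV x y Vxy; rewrite ler_pdivlMr// -subr_ge0.
  apply: (@ge0_of_ge _ _ (2 * topval + 2)) => d d0.
  have [g Ag fg] := fA d [:: x; y] d0.
  have := near_top_modulus (Atop _ _ Ag) kV Vxy; rewrite ler_pdivlMr//.
  have := fg x; have := fg y; rewrite !inE !eqxx orbT => /(_ isT) h1 /(_ isT) h2 h3.
  have : `|f x - f y| <= 2 * d + `|g x - g y|.
    move: h1 h2; have := ler_norm (g x - g y); have := ler_norm (- (g x - g y)).
    rewrite normrN !ler_distl => + + /andP[? ?] /andP[? ?] => ? ?.
    by apply/andP; split; lra.
  move=> /(ler_wpM2r (ltW l0)); rewrite mulrDl; lra.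
have fu : ucont f.
  move=> e e0; have [V V0 kV] := k_ucont (mulr_gt0 e0 l0).
  by exists V => //; rewrite -(mulfK (lt0r_neq0 l0) e); exact: fmod.
have f0 : f 0 = 1.
  apply: (@eq_of_dist _ _ _ 1) => e e0; have [g Ag fg] := fA e [:: 0] e0.
  by have [[_ _ g0] _] := Atop _ _ Ag; rewrite mul1r -g0; apply: fg; rewrite inE.
have fp : posdef f.
  split=> [x|l].
    apply: (@eq_of_dist _ _ _ 2) => e e0.
    have [g Ag fg] := fA e [:: x; - x] e0.
    have [[_ [gN _] _] _] := Atop _ _ Ag.
    have := fg x; have := fg (- x); rewrite !inE !eqxx orbT gN.
    rewrite !ler_distl => /(_ isT)/andP[? ?] /(_ isT)/andP[? ?].
    by apply/andP; split; lra.
  pose s := [seq 0 + (p.2 - q.2) | p <- l, q <- l].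
  apply: (@ge0_of_ge _ _ (\sum_(p <- l) \sum_(q <- l) `|p.1 * q.1|)) => e e0.
  have [g Ag fg] := fA e s e0.
  have [[_ [_ gp] _] _] := Atop _ _ Ag.
  have : `|qshift g l 0 - qshift f l 0| <= (\sum_(p <- l) \sum_(q <- l) `|p.1 * q.1|) * e.
    rewrite /qshift -sumrB mulr_suml; apply: le_trans (ler_norm_sum _ _ _) _.
    rewrite big_seq [X in _ <= X]big_seq; apply: ler_sum => p pl.
    rewrite -sumrB mulr_suml; apply: le_trans (ler_norm_sum _ _ _) _.
    rewrite big_seq [X in _ <= X]big_seq; apply: ler_sum => q ql.
    rewrite -mulrBr normrM ler_wpM2l// distrC; apply: fg.
    by apply/allpairsP; exists (p, q).
  have := gp l; rewrite ler_distl => ? /andP[? ?]; lra.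
have fb x : `|f x| <= 1 by apply: pdstate_bound.
have [B B0 kB] := ucont_bounded Hc k_ucont.
(* with modulus 3 * e / topval for f and g, the products k * f, k * g, f * f and
   g * g all have modulus C' * e *)
pose C' := (B + 2) * (3 / topval) + (B + 3).
have l3 : 0 <= 3 / topval by rewrite divr_ge0// ltW.
have key e : 0 < e -> exists g, [/\ A e g,
    `|mean (fun x => k x * f x) - mean (fun x => k x * g x)| <= 7 * (C' * e) &
    `|mean (fun x => f x * f x) - mean (fun x => g x * g x)| <= 7 * (C' * e)].
  move=> e0; have [V V0 kV] := k_ucont e0.
  have C0 : 0 < C' * e.
    rewrite mulr_gt0// /C' ltr_wpDl//; last by lra.
    by rewrite mulr_ge0//; lra.
  have [s hs] := mean_close (B + 1) V0 C0.
  have [g Ag fg] := fA e s e0; have tg := Atop _ _ Ag.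
  have gb x : `|g x| <= 1 by apply: pdstate_bound tg.1.
  have gV : modulus V (3 / topval * e) g.
    apply: modulusW (near_top_modulus tg kV) => //.
    by rewrite mulrAC ler_wpM2r ?invr_ge0 ?(ltW l0)//; lra.
  have fV : modulus V (3 / topval * e) f.
    apply: modulusW (fmod _ _ kV) => //.
    by rewrite mulrAC ler_wpM2r ?invr_ge0 ?(ltW l0)//; lra.
  have l3e : 0 <= 3 / topval * e by rewrite mulr_ge0// ltW.
  have Be : 0 <= B * (3 / topval * e) by rewrite mulr_ge0// ltW.
  have Be' : 0 <= B * e by rewrite mulr_ge0// ltW.
  have CE : C' * e = B * (3 / topval * e) + 2 * (3 / topval * e) + B * e + 3 * e.
    by rewrite /C'; ring.
  exists g; split=> //; apply: hs.
  - by move=> x; rewrite normrM -[B + 1]mulr1; apply: ler_pM => //; rewrite (le_trans (kB x))//; lra.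
  - by move=> x; rewrite normrM -[B + 1]mulr1; apply: ler_pM => //; rewrite (le_trans (kB x))//; lra.
  - by apply: modulusW (modulusM kB fb kV fV) => //; rewrite CE; lra.
  - by apply: modulusW (modulusM kB gb kV gV) => //; rewrite CE; lra.
  - move=> x xs; rewrite -mulrBr normrM (@le_trans _ _ (B * e))//; last by rewrite CE; lra.
    by apply: ler_pM => //; exact: fg.
  - by move=> x; rewrite normrM (@le_trans _ _ (1 * 1))//; [apply: ler_pM|lra].
  - by move=> x; rewrite normrM (@le_trans _ _ (1 * 1))//; [apply: ler_pM|lra].
  - by apply: modulusW (modulusM fb fb fV fV) => //; rewrite CE; lra.
  - by apply: modulusW (modulusM gb gb gV gV) => //; rewrite CE; lra.
  - move=> x xs; have -> : f x * f x - g x * g x = (f x + g x) * (f x - g x) by ring.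
    rewrite normrM (@le_trans _ _ (2 * e))//; last by rewrite CE; lra.
    apply: ler_pM => //; last exact: fg.
    by apply: le_trans (ler_normD _ _) _; have := fb x; have := gb x; lra.
split.
  split; first by [].
  rewrite subr0 -subr_ge0; apply: (@ge0_of_ge _ _ (1 + 7 * C')) => e e0.
  have [g [Ag + _]] := key e e0; have [_] := Atop _ _ Ag.
  by rewrite ler_distl => ? /andP[? ?]; lra.
exists (7 * C') => e e0; have [g [Ag _ h]] := key e e0.
by exists g => //; rewrite -mulrA.
Qed.

(** Pointwise limits of almost maximal functions are maximal. The mean of the square
is strictly convex, so that maximising it as well selects an extreme point of the set
of eigenfunctions. *)
Lemma extremal_exists : exists2 h, near_top 0 h &
  forall u, near_top 0 u -> mean (fun x => u x * u x) <= mean (fun x => h x * h x).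
Proof.
pose S (e : R) := [set a | exists2 h, near_top e h & a = mean (fun x => h x * h x)].
have topne e : 0 < e -> near_top e !=set0.
  move=> e0.
  have hs : has_sup [set a | exists2 h, pdstate h & a = mean (fun y => k y * h y)].
    split.
      exists (mean (fun y => k y * ((k 0)^-1 * k y))), (fun x => (k 0)^-1 * k x) => //.
      split; [exact: ucontZ| |exact: (mulVf (lt0r_neq0 k0_gt0))].
      by apply: posdefZ => //; rewrite invr_ge0 ltW.
    by exists topval => _ [h ph ->]; exact: topval_ub.
  have [_ [h ph ->] /ltW lt] := sup_adherent e0 hs.
  by exists h.
have S1 e : ubound (S e) 1.
  move=> _ [h [ph _] ->]; case: (ph) => hu _ _; apply: mean_le_cst => //; first exact: ucontM.
  move=> x; apply: le_trans (ler_norm _) _; rewrite normrM -[1]mulr1.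
  by apply: ler_pM => //; exact: pdstate_bound.
have S0 e a : S e a -> 0 <= a.
  move=> [h [[hu _ _] _] ->]; apply: mean_ge_cst => //; first exact: ucontM.
  by move=> x; rewrite -expr2 sqr_ge0.
have Sne e : 0 < e -> S e !=set0.
  by move=> /topne[h th]; exists (mean (fun x => h x * h x)), h.
(* the limit, as e tends to 0, of the largest quadratic mean over near_top e; it bounds
   the quadratic mean of every exact eigenfunction *)
pose mu := inf [set sup (S e) | e in [set e : R | 0 < e]].
have muL : has_lbound [set sup (S e) | e in [set e : R | 0 < e]].
  exists 0 => _ [e e0 <-]; have [a Sa] := Sne e e0.
  by apply: le_trans (S0 _ _ Sa) _; apply: ub_le_sup Sa; exists 1.
pose A e := [set h | near_top e h /\ mu - e <= mean (fun x => h x * h x)].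
have Ane e : 0 < e -> A e !=set0.
  move=> e0; have hs : has_sup (S e) by split; [exact: Sne|exists 1].
  have [_ [h th ->] lt] := sup_adherent e0 hs.
  exists h; split => //; apply: le_trans (ltW lt); rewrite lerB//.
  by apply: ge_inf => //; exists e.
have Amon e e' : e <= e' -> A e `<=` A e'.
  move=> ee h [[ph hk] hm]; split; first split=> //.
    by apply: le_trans hk; rewrite lerB.
  by apply: le_trans hm; rewrite lerB.
have Abd e f x : A e f -> `|f x| <= 1 by move=> [[ph _] _]; exact: pdstate_bound.
have [h hcl] := pointwise_cluster Ane Amon Abd.
have [htop [C hC]] := @cluster_near_top A h (fun e g Ag => Ag.1) hcl.
exists h => // u [pu ku]; apply: (@le_trans _ _ mu).
  apply: lb_le_inf; first by exists (sup (S 1)), 1 => //=.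
  move=> _ [e /= e0 <-]; apply: ub_le_sup; first by exists 1.
  exists u => //; split=> //; apply: le_trans ku; lra.
rewrite -subr_ge0; apply: (@ge0_of_ge _ _ (1 + C)) => e e0.
have [g [_ gm]] := hC e e0; rewrite ler_distl => /andP[? ?]; lra.
Qed.

End Spectral.

(** * From d'Alembert's functional equation to characters *)

Section DAlembert.
Variables (R : realType) (H : topologicalZmodType).
Hypothesis Hc : compact [set: H].
Implicit Types (f g h : H -> R).

Lemma mean_sqr_eq0 f : ucont f -> mean (fun x => f x * f x) <= 0 -> forall x, f x = 0.
Proof.
move=> fu f0 x; apply: contrapT => /eqP fx.
have : 0 < mean (fun x => f x * f x).
  apply: (@mean_gt0 _ _ Hc _ x); first exact: ucontM.
    by move=> y; rewrite -expr2 sqr_ge0.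
  by rewrite -expr2 exprn_even_gt0.
by rewrite ltNge f0.
Qed.

Variable k : H -> R.
Hypotheses (k_ucont : ucont k) (k_posdef : posdef k) (k0_gt0 : 0 < k 0).

(** The functions p 1 and p (-1) are positive definite with sum 4 * h. As topval bounds
the mean of k against both, and h attains the bound, they are multiples of
eigenfunctions u and v, and h is a convex combination of u and v. Strict convexity of
the quadratic mean forces u = v = h, which is the functional equation; if one of p 1
and p (-1) vanishes at 0, it vanishes identically and the equation is immediate. *)
Lemma extremal_dAlembert h : near_top k 0 h ->
  (forall u, near_top k 0 u -> mean (fun x => u x * u x) <= mean (fun x => h x * h x)) ->
  forall x a, h (x + a) + h (x - a) = 2 * h a * h x.
Proof.
move=> [[hu hp h0] hk] hmax x a.
have hN := hp.1.
pose p (c : R) := qshift h [:: (1, 0); (c, a)].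
have pu c : ucont (p c) by exact: ucont_qshift.
have pp c : posdef (p c) by exact: posdef_qshift.
have pE c y : p c y = (1 + c ^+ 2) * h y + c * (h (y + a) + h (y - a)).
  exact: qshift_pair.
have p1E y : p 1 y = 2 * h y + (h (y + a) + h (y - a)) by rewrite pE; ring.
have p2E y : p (-1) y = 2 * h y - (h (y + a) + h (y - a)) by rewrite pE; ring.
have p10 : p 1 0 = 2 * (1 + h a) by rewrite p1E add0r sub0r hN h0; ring.
have p20 : p (-1) 0 = 2 * (1 - h a) by rewrite p2E add0r sub0r hN h0; ring.
have := posdef_ge0 (pp 1); rewrite le_eqVlt => /predU1P[p1z|p1pos].
  have := posdef_bound x (pp 1); rewrite -p1z normr_le0 p1E => /eqP e1.
  have ha : h a = -1 by move: p10; rewrite -p1z; lra.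
  by rewrite ha; lra.
have := posdef_ge0 (pp (-1)); rewrite le_eqVlt => /predU1P[p2z|p2pos].
  have := posdef_bound x (pp (-1)); rewrite -p2z normr_le0 p2E => /eqP e1.
  have ha : h a = 1 by move: p20; rewrite -p2z; lra.
  by rewrite ha; lra.
pose al := (1 + h a) / 2; pose be := (1 - h a) / 2.
have al0 : 0 < al by rewrite /al; lra.
have be0 : 0 < be by rewrite /be; lra.
have p10' : p 1 0 = 4 * al by rewrite p10 /al; lra.
have p20' : p (-1) 0 = 4 * be by rewrite p20 /be; lra.
pose u y := (p 1 0)^-1 * p 1 y; pose v y := (p (-1) 0)^-1 * p (-1) y.
have uu : ucont u by exact: ucontZ.
have vu : ucont v by exact: ucontZ.
have hE y : h y = al * u y + be * v y.
  by rewrite /u /v p10' p20' p1E p2E; field; rewrite !gt_eqF.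
have ku w : ucont w -> ucont (fun y => k y * w y) by move=> ?; exact: ucontM.
have psu : pdstate u.
  split=> //; last by rewrite /u mulVf ?gt_eqF.
  by apply: posdefZ => //; rewrite invr_ge0 ltW.
have psv : pdstate v.
  split=> //; last by rewrite /v mulVf ?gt_eqF.
  by apply: posdefZ => //; rewrite invr_ge0 ltW.
have tu := topval_ub Hc k_ucont psu; have tv := topval_ub Hc k_ucont psv.
have mh : mean (fun y => k y * h y) =
    al * mean (fun y => k y * u y) + be * mean (fun y => k y * v y).
  rewrite -!meanZ//; try exact: ku.
  rewrite -meanD//; try by apply: ucontZ; exact: ku.
  by congr mean; apply/funext => y; rewrite hE; ring.
have ab : al + be = 1 by rewrite /al /be; lra.
have nu : near_top k 0 u by split=> //; move: hk; rewrite mh !subr0; nra.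
have nv : near_top k 0 v by split=> //; move: hk; rewrite mh !subr0; nra.
have su := hmax _ nu; have sv := hmax _ nv.
have uu2 := ucontM Hc uu uu; have vv2 := ucontM Hc vu vu; have uvu := ucontB uu vu.
have hh : mean (fun x => h x * h x) =
    al * mean (fun x => u x * u x) + be * mean (fun x => v x * v x)
    - (al * be) * mean (fun x => (u x - v x) * (u x - v x)).
  rewrite -!meanZ//; last exact: ucontM.
  rewrite -meanD//; try exact: ucontZ.
  rewrite -meanB//; last by apply: ucontZ; exact: ucontM.
    by congr mean; apply/funext => y; rewrite hE /al /be; field.
  by apply: ucontD; exact: ucontZ.
have d0 : mean (fun x => (u x - v x) * (u x - v x)) <= 0.
  have abp : 0 < al * be by exact: mulr_gt0.
  rewrite -(pmulr_rle0 _ abp).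
  move: (ler_wpM2l (ltW al0) su) (ler_wpM2l (ltW be0) sv) => h1 h2.
  have e1 : mean (fun x => h x * h x) =
      al * mean (fun x => h x * h x) + be * mean (fun x => h x * h x).
    by rewrite -mulrDl ab mul1r.
  by move: h1 h2 e1; rewrite hh; lra.
have uv := mean_sqr_eq0 uvu d0 x.
have hux : h x = u x.
  have -> : h x = al * u x + be * v x by exact: hE.
  have -> : v x = u x by lra.
  by rewrite -mulrDl ab mul1r.
have : p 1 x = p 1 0 * h x by rewrite hux /u mulrA mulfV ?gt_eqF ?mul1r.
by rewrite p1E p10 => e1; lra.
Qed.

End DAlembert.

Section Characters.
Variables (R : realType) (H : topologicalZmodType).
Hypothesis Hc : compact [set: H].

(** The kernel k is chosen so that its Fourier coefficient at a character equal to 1 at z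
vanishes, while k 0 > 0 because phi is not invariant under z. If h z = 1, then h is
invariant under z up to symmetrisation, so its mean against k is 0, although that
mean is the positive number topval. *)
Lemma dAlembert_separating (phi : H -> R) (z : H) : ucont phi -> phi z != phi 0 ->
  exists h : H -> R, [/\ ucont h, h 0 = 1, forall x, `|h x| <= 1,
    forall x a, h (x + a) + h (x - a) = 2 * h a * h x & h z != 1].
Proof.
move=> phiu phiz.
pose k0 := autocorr phi; pose k := qshift k0 [:: (1, 0); (-1, z)].
have k0u : ucont k0 by exact: ucont_autocorr.
have k0p : posdef k0 by exact: posdef_autocorr.
have ku : ucont k by exact: ucont_qshift.
have kp : posdef k by exact: posdef_qshift.
have kE y : k y = 2 * k0 y - (k0 (y + z) + k0 (y - z)).
  by rewrite /k qshift_pair; ring.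
have kpos : 0 < k 0.
  rewrite lt_neqAle posdef_ge0// andbT eq_sym; apply/negP => /eqP k00.
  pose psi w := phi w - phi (w + z).
  have psiu : ucont psi by apply: ucontB => //; exact: ucont_shift.
  suff : mean (fun w => psi w * psi w) <= 0.
    move=> /(mean_sqr_eq0 Hc psiu)/(_ 0)/eqP; rewrite /psi add0r subr_eq0 eq_sym.
    exact/negP.
  have E : mean (fun w => psi w * psi w) =
      mean (fun w => phi w * phi w) + mean (fun w => phi (w + z) * phi (w + z))
      - 2 * mean (fun w => phi w * phi (w + z)).
    have pz := ucont_shift z phiu.
    rewrite -meanZ//; last exact: ucontM.
    rewrite -meanD//; try exact: ucontM.
    rewrite -meanB//; last by apply: ucontZ; exact: ucontM.
      by congr mean; apply/funext => w; rewrite /psi; ring.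
    by apply: ucontD; exact: ucontM.
  have E2 : mean (fun w => phi (w + z) * phi (w + z)) = mean (fun w => phi w * phi w).
    by rewrite (mean_shift Hc z (ucontM Hc phiu phiu)).
  have E3 : k0 0 = mean (fun w => phi w * phi w).
    by rewrite /k0 /autocorr; congr mean; apply/funext => w; rewrite addr0.
  have := k00; rewrite kE add0r sub0r k0p.1 E3 E E2 /k0 /autocorr; lra.
have [h htop hmax] := extremal_exists Hc ku kp kpos.
have dA := extremal_dAlembert Hc ku htop hmax.
case: (htop) => [[hu hp h0] hk].
exists h; split => //; first by move=> x; exact: (pdstate_bound x htop.1).
apply/negP => /eqP hz.
have l0 := topval_gt0 Hc ku kp kpos.
have := lt_le_trans l0 (_ : topval k <= 0); rewrite ltxx => F; apply: notF; apply: F.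
move: hk; rewrite subr0 => /le_trans; apply.
pose m0 y := k0 y * h y.
have m0u : ucont m0 by exact: ucontM.
have k0z a : ucont (fun y => k0 (y + a) * h y).
  by apply: ucontM => //; exact: ucont_shift.
have E : mean (fun y => k y * h y) = 2 * mean m0 -
    (mean (fun y => k0 (y + z) * h y) + mean (fun y => k0 (y - z) * h y)).
  rewrite -meanZ// -meanD// -meanB//; last exact: ucontD.
    by congr mean; apply/funext => y; rewrite kE /m0; ring.
  exact: ucontZ.
have S a : mean (fun y => k0 (y + a) * h y) = mean (fun y => k0 y * h (y - a)).
  rewrite -(mean_shift Hc (- a) (k0z a)); congr mean; apply/funext => y.
  by rewrite subrK.
have k0h a : ucont (fun y => k0 y * h (y + a)).
  by apply: ucontM => //; exact: ucont_shift.
rewrite E !S opprK -meanD//.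
have -> : (fun x => k0 x * h (x - z) + k0 x * h (x + z)) = fun y => 2 * m0 y.
  by apply/funext => y; rewrite -mulrDr addrC dA hz /m0; ring.
by rewrite meanZ// subrr.
Qed.

(** The pair of the real and imaginary parts of a continuous homomorphism to the
circle. *)
Definition character (c s : H -> R) :=
  [/\ continuous c, continuous s, forall x y, c (x + y) = c x * c y - s x * s y,
      forall x y, s (x + y) = s x * c y + c x * s y &
      forall x, c x ^+ 2 + s x ^+ 2 = 1].

Hypothesis Hconn : connected [set: H].

Lemma continuous_sign (h : H -> R) : continuous h -> h 0 = 1 -> (forall x, h x ^+ 2 = 1) ->
  forall x, h x = 1.
Proof.
move=> hcont h0 h2.
have E : [set x | 0 < h x] = [set: H].
  apply: Hconn; first by exists 0; rewrite /= h0.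
    exists [set x | 0 < h x]; last by rewrite setTI.
    by apply: (open_comp _ (@open_gt R 0)) => x _; exact: hcont.
  exists [set x | 0 <= h x].
    by apply: (closed_comp _ (@closed_ge R 0)) => x _; exact: hcont.
  rewrite setTI; apply/seteqP; split=> x /=; first exact: ltW.
  rewrite le_eqVlt => /predU1P[hx|//]; have := h2 x.
  by rewrite -hx expr0n => /esym/eqP; rewrite oner_eq0.
move=> x; have : [set x | 0 < h x] x by rewrite E.
move=> /= hx; have /eqP := h2 x; rewrite sqrf_eq1 => /orP[/eqP//|/eqP hx1].
by move: hx; rewrite hx1 ltr0N1.
Qed.

(** The function h is the cosine of an angle; the sine is obtained from the
addition formula at a point a where sin is nonzero. Such an a exists since a
continuous function with values 1 and -1 on a connected group is constant. *)
Lemma dAlembert_character (h : H -> R) : ucont h -> h 0 = 1 -> (forall x, `|h x| <= 1) ->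
  (forall x a, h (x + a) + h (x - a) = 2 * h a * h x) ->
  (exists z, h z != 1) -> exists s, character h s.
Proof.
move=> hu h0 h1 dA [z hz].
have [a ha] : exists a, h a ^+ 2 != 1.
  apply: contrapT => na; move/eqP: hz; apply.
  apply: (continuous_sign (ucont_continuous hu) h0) => x.
  by apply: contrapT => hx; apply: na; exists x; exact/eqP.
have hN x : h (- x) = h x by have := dA 0 x; rewrite add0r sub0r h0; lra.
have dA' x y : h x * h y = (h (x + y) + h (x - y)) / 2 by rewrite dA; lra.
have h2 x : h (x + x) = 2 * h x ^+ 2 - 1.
  by have := dA x x; rewrite subrr h0; lra.
have pr x y : h (x + y) * h (x - y) = h x ^+ 2 + h y ^+ 2 - 1.
  rewrite dA' addrACA subrr addr0 opprB (addrC y) addrA.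
  rewrite (_ : x + y - x + y = y + y) ?h2; first lra.
  by rewrite (addrC x) addrK.
have hlt : 0 < 1 - h a ^+ 2.
  rewrite subr_gt0 lt_neqAle ha /= -real_normK ?num_real//.
  by rewrite expr_le1.
pose sg := Num.sqrt (1 - h a ^+ 2).
have sg0 : 0 < sg by rewrite sqrtr_gt0.
have sg2 : sg ^+ 2 = 1 - h a ^+ 2 by rewrite sqr_sqrtr// ltW.
pose d x := h (x - a) - h (x + a).
pose s x := (2 * sg)^-1 * d x.
have sg20 : 2 * sg != 0 by rewrite mulf_neq0 ?gt_eqF.
have sE x : 2 * sg * s x = d x by rewrite /s mulrA mulfV ?mul1r.
have dd x y : d x * d y = 2 * sg ^+ 2 * (h (x - y) - h (x + y)).
  have -> : d x * d y = h (x - a) * h (y - a) - h (x - a) * h (y + a)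
      - h (x + a) * h (y - a) + h (x + a) * h (y + a) by rewrite /d; ring.
  rewrite !dA' sg2.
  have -> : x - a + (y - a) = x + y - (a + a) by rewrite opprD addrACA.
  have -> : x - a - (y - a) = x - y by rewrite opprB addrA subrK.
  have -> : x - a + (y + a) = x + y by rewrite (addrC y) addrA subrK.
  have -> : x - a - (y + a) = x - y - (a + a) by rewrite !opprD addrACA.
  have -> : x + a + (y - a) = x + y by rewrite (addrC y) addrA addrK.
  have -> : x + a - (y - a) = x - y + (a + a) by rewrite opprB (addrC a (- y)) addrACA.
  have -> : x + a + (y + a) = x + y + (a + a) by rewrite addrACA.
  have -> : x + a - (y + a) = x - y by rewrite opprD (addrC (- y)) addrA addrK.
  have := dA (x + y) (a + a); have := dA (x - y) (a + a); rewrite !h2.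
  move: (h (x + y + (a + a))) (h (x + y - (a + a))) (h (x - y + (a + a)))
    (h (x - y - (a + a))) => p1 p2 p3 p4 e1 e2.
  have -> : p3 = 2 * (2 * h a ^+ 2 - 1) * h (x - y) - p4 by rewrite -e1; ring.
  have -> : p1 = 2 * (2 * h a ^+ 2 - 1) * h (x + y) - p2 by rewrite -e2; ring.
  by field.
have ss x y : s x * s y = (h (x - y) - h (x + y)) / 2.
  apply: (mulfI (mulf_neq0 sg20 sg20)).
  have -> : 2 * sg * (2 * sg) * (s x * s y) = (2 * sg * s x) * (2 * sg * s y) by ring.
  by rewrite !sE dd; field.
exists s; split => //.
- exact: ucont_continuous.
- apply: ucont_continuous; have := ucontZ (2 * sg)^-1 (ucontB (ucont_shift (- a) hu) (ucont_shift a hu)).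
  exact.
- by move=> x y; rewrite ss dA'; field.
- move=> x y; apply: (mulfI sg20).
  have -> : 2 * sg * (s x * h y + h x * s y) =
    (2 * sg * s x) * h y + h x * (2 * sg * s y) by ring.
  rewrite !sE /d.
  have -> : (h (x - a) - h (x + a)) * h y + h x * (h (y - a) - h (y + a)) =
    h (x - a) * h y - h (x + a) * h y + h x * h (y - a) - h x * h (y + a) by ring.
  rewrite !dA'.
  have -> : x - a + y = x + y - a by rewrite addrAC.
  have -> : x + a + y = x + y + a by rewrite addrAC.
  have -> : x - a - y = x - y - a by rewrite addrAC.
  have -> : x + a - y = x - y + a by rewrite addrAC.
  have -> : x + (y - a) = x + y - a by rewrite addrA.
  have -> : x - (y - a) = x - y + a by rewrite opprB addrA addrAC.
  have -> : x + (y + a) = x + y + a by rewrite addrA.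
  have -> : x - (y + a) = x - y - a by rewrite opprD addrA.
  by field.
- by move=> x; rewrite (expr2 (s x)) ss subrr h0 h2; field.
Qed.

End Characters.

(** * Rounding weights to 0 and 1 *)

Section Rounding.
Variables (R : realFieldType) (N d : nat) (M : 'M[R]_(N, d)).

Definition fractional (w : 'I_N -> R) := [set n | 0 < w n < 1]%SET.

(** More than d rows of M are linearly dependent. Moving the fractional weights along a
dependency preserves the weighted sum; the motion stops when the first weight
reaches 0 or 1. *)
Lemma rounding_step (w : 'I_N -> R) : (forall n, 0 <= w n <= 1) ->
  (d < #|fractional w|)%N ->
  exists w', [/\ forall n, 0 <= w' n <= 1,
    forall j, \sum_n w' n * M n j = \sum_n w n * M n j &
    (#|fractional w'| < #|fractional w|)%N].
Proof.
move=> w01 dT; set T := fractional w in dT *.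
pose Q : 'M[R]_(#|T|, d) := \matrix_(i, j) M (enum_val i) j.
have /rowV0Pn[u /sub_kermxP uQ u0] : kermx Q != 0.
  rewrite kermx_eq0; apply/negP => /eqP rQ.
  by have := rank_leq_col Q; rewrite rQ leqNgt dT.
have [i0 ui0] : exists i, u 0 i != 0.
  by apply/existsP; apply: contraNT u0 => /existsPn h; apply/eqP/rowP => i;
    rewrite mxE; apply/eqP; rewrite -[_ == _]negbK h.
pose c n := if n \in T then u 0 (enum_rank_in (enum_valP i0) n) else 0.
have cT n : n \notin T -> c n = 0 by rewrite /c => /negbTE ->.
have cval i : c (enum_val i) = u 0 i by rewrite /c enum_valP enum_valK_in.
have cM j : \sum_n c n * M n j = 0.
  rewrite (bigID [in T]) /= [X in _ + X]big1 ?addr0; last first.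
    by move=> n /cT ->; rewrite mul0r.
  have /matrixP/(_ 0 j) := uQ; rewrite !mxE; apply: etrans.
  rewrite [LHS](big_enum_val (fun n => c n * M n j)); apply: eq_bigr => i _.
  by rewrite cval mxE.
(* the time at which the weight of n reaches 1, or 0 when it decreases *)
pose tau n := if 0 < c n then (1 - w n) / c n else - w n / c n.
have cn0 : c (enum_val i0) != 0 by rewrite cval.
case: (@Order.TotalTheory.arg_minP _ R _ _ (fun n => c n != 0) tau cn0) => m cm tmin.
have cfrac n : c n != 0 -> 0 < w n < 1.
  by move=> h; have : n \in T by [apply: contraNT h => /cT ->]; rewrite inE.
have tau0 : 0 <= tau m.
  have /andP[w0 w1] := cfrac _ cm; rewrite /tau; case: ltP => c0.
    by apply: divr_ge0; rewrite ?subr_ge0 ltW.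
  by rewrite mulNr -mulrN; apply: mulr_ge0; [exact: ltW|rewrite oppr_ge0 invr_le0].
exists (fun n => w n + tau m * c n); split.
- move=> n; have [cn|cn] := eqVneq (c n) 0; first by rewrite cn mulr0 addr0.
  have /andP[w0 w1] := cfrac _ cn; have := tmin n cn; rewrite {2}/tau.
  case: ltP => [c0|]; first rewrite ler_pdivlMr// => h.
    have : 0 <= tau m * c n by rewrite mulr_ge0// ltW.
    by move=> h'; apply/andP; split; lra.
  rewrite le_eqVlt (negbTE cn) /= => c0; rewrite ler_ndivlMr// => h.
  have : tau m * c n <= 0 by rewrite mulr_ge0_le0// ltW.
  by move=> h'; apply/andP; split; lra.
- move=> j; under eq_bigr do rewrite mulrDl -mulrA.
  by rewrite big_split /= -mulr_sumr cM mulr0 addr0.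
- apply: proper_card; apply/properP; split.
    apply/fintype.subsetP => n; rewrite !inE => h; apply/negP => /negP hn.
    have cn : c n = 0 by apply: cT; rewrite inE.
    by move: h; rewrite cn mulr0 addr0; exact/negP.
  exists m; first by rewrite inE cfrac.
  rewrite inE /tau; case: (ltP 0 (c m)) => c0.
    by rewrite divfK// addrC subrK ltxx andbF.
  by rewrite divfK// addrC addNr ltxx.
Qed.

(** The Shapley-Folkman argument: at most d weights have to stay fractional, and
each of them costs at most delta when it is replaced by 0. *)
Lemma rounding (delta t : R) : 0 <= delta -> 0 <= t <= 1 -> (forall n j, `|M n j| <= delta) ->
  exists A : {set 'I_N}, forall j,
    `|\sum_(n in A) M n j - t * \sum_n M n j| <= d%:R * delta.
Proof.
move=> d0 t01 Md.
have key : forall k (w : 'I_N -> R), (#|fractional w| <= k)%N ->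
    (forall n, 0 <= w n <= 1) ->
    exists w', [/\ forall n, 0 <= w' n <= 1,
      forall j, \sum_n w' n * M n j = \sum_n w n * M n j &
      (#|fractional w'| <= d)%N].
  elim=> [|k IH] w wk w01; first by exists w; split => //; rewrite (leq_trans wk).
  have [le|lt] := leqP #|fractional w| d; first by exists w.
  have [w1 [w101 w1M w1f]] := rounding_step w01 lt.
  have [w2 [w201 w2M w2f]] := IH w1 (ltac:(by rewrite -ltnS (leq_trans w1f))) w101.
  by exists w2; split => // j; rewrite w2M.
have [w [w01 wM wf]] := key _ (fun=> t) (leqnn _) (fun=> t01).
exists [set n | w n == 1]%SET => j.
rewrite mulr_sumr -wM big_mkcond /= -sumrB.
rewrite (bigID [in fractional w]) /= [X in _ + X]big1 ?addr0; last first.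
  move=> n; rewrite !inE; have /andP[w0 w1] := w01 n; case: eqP => [->|/eqP n1].
    by rewrite mul1r subrr.
  have -> : w n < 1 by rewrite lt_neqAle n1.
  rewrite andbT lt_def w0 andbT negbK => /eqP ->.
  by rewrite mul0r subrr.
apply: le_trans (ler_norm_sum _ _ _) _.
apply: le_trans (_ : \sum_(n in fractional w) delta <= _).
  apply: ler_sum => n; rewrite !inE => /andP[w0 w1].
  rewrite (lt_eqF w1) sub0r normrN normrM gtr0_norm//.
  by apply: le_trans (Md n j); rewrite ler_piMl// ltW.
rewrite sumr_const -[leLHS]mulr_natl.
by rewrite ler_wpM2r// ler_nat.
Qed.

End Rounding.

(** * Characters separate points *)

Section CharacterTheory.
Variables (R : realType) (H : topologicalZmodType).
Implicit Types c s : H -> R.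

Lemma character0 c s : character c s -> c 0 = 1 /\ s 0 = 0.
Proof.
move=> [_ _ cD sD cs].
have := cD 0 0; have := sD 0 0; have := cs 0; rewrite addr0.
move: (c 0) (s 0) => a b e1 e2 e3.
have b0 : b * (1 - 2 * a) = 0 by nra.
have a0 : a * (1 - a) = - b ^+ 2 by nra.
move/eqP: b0; rewrite mulf_eq0 => /orP[/eqP b0|/eqP h].
  split => //; move/eqP: a0; rewrite b0 expr0n oppr0 mulf_eq0 => /orP[/eqP a0|/eqP]; last lra.
  by move: e1; rewrite a0 b0 !expr0n addr0 => /eqP; rewrite eq_sym oner_eq0.
have a2 : a = 2^-1 by lra.
by move: a0; rewrite a2 => a0; nra.
Qed.

Lemma characterN c s : character c s ->
  (forall x, c (- x) = c x) /\ (forall x, s (- x) = - s x).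
Proof.
move=> ch; have [c0 s0] := character0 ch; case: ch => _ _ cD sD cs.
suff h x : c (- x) = c x /\ s (- x) = - s x by split=> x; case: (h x).
have := cD x (- x); have := sD x (- x); have := cs x; rewrite subrr c0 s0.
move: (c (- x)) (s (- x)) (c x) (s x) => c' s' a b e1 e2 e3.
split.
  have -> : c' = (a ^+ 2 + b ^+ 2) * c' by rewrite e1 mul1r.
  have -> : (a ^+ 2 + b ^+ 2) * c' = a * (a * c' - b * s') + b * (b * c' + a * s') by ring.
  by rewrite -e2 -e3; ring.
have -> : s' = (a ^+ 2 + b ^+ 2) * s' by rewrite e1 mul1r.
have -> : (a ^+ 2 + b ^+ 2) * s' = a * (b * c' + a * s') - b * (a * c' - b * s') by ring.
by rewrite -e2 -e3; ring.
Qed.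

Lemma character_le1 c s x : character c s -> c x <= 1.
Proof. by case=> _ _ _ _ /(_ x) h; nra. Qed.

Lemma character_trivial : character (fun=> 1 : R) (fun _ : H => 0 : R).
Proof.
split=> [x|x|x y|x y|x]; [exact: cst_continuous|exact: cst_continuous|..]; ring.
Qed.

Lemma character_comp (X : topologicalZmodType) (B : {additive X -> H}) c s :
  continuous B -> character c s -> character (c \o B) (s \o B).
Proof.
move=> Bc [cc sc cD sD cs]; split=> [x|x|x y|x y|x] /=.
- by apply: continuous_comp; [exact: Bc|exact: cc].
- by apply: continuous_comp; [exact: Bc|exact: sc].
- by rewrite raddfD cD.
- by rewrite raddfD sD.
- exact: cs.
Qed.

End CharacterTheory.

Section Separation.
Variables (R : realType) (H : topologicalZmodType).
Hypotheses (Hc : compact [set: H]) (Hconn : connected [set: H]).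
Hypothesis Hm : metrizable R H.

Lemma metrizable_separation (z : H) : z != 0 ->
  exists2 phi : H -> R, continuous phi & phi z != phi 0.
Proof.
move=> z0; have [d [d0 dE dC dT dn]] := Hm.
exists (d 0).
  move=> x; apply/cvgrPdist_lt => e e0.
  have : nbhs x [set y | d x y < e] by rewrite dn; exists e.
  apply: filterS => y /= dxy; rewrite distrC ltr_distl.
  by have := dT 0 x y; have := dT 0 y x; rewrite (dC y x) => *; apply/andP; split; lra.
have d00 : d 0 0 = 0 by apply/dE.
by rewrite d00; apply: contra z0 => /eqP/dE ->.
Qed.

Lemma exists_character (z : H) : z != 0 ->
  exists c s : H -> R, character c s /\ c z != 1.
Proof.
move=> /metrizable_separation[phi phic phiz].
have [h [hu h0 h1 dA hz]] := dAlembert_separating Hc (continuous_ucont Hc phic) phiz.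
by have [|s chs] := dAlembert_character Hconn hu h0 h1 dA; [exists z|exists h, s].
Qed.

(** Every point other than 0 has a neighbourhood on which some character stays away
from 1; finitely many such neighbourhoods, together with U, cover the group. *)
Lemma finite_characters (U : set H) : nbhs (0 : H) U ->
  exists m (c s : 'I_m -> H -> R) (eta : R), [/\ 0 < eta,
    forall j, character (c j) (s j) &
    forall z, (forall j, 1 - eta < c j z) -> U z].
Proof.
move=> U0.
pose triv : (H -> R) * (H -> R) := (fun=> 1, fun=> 0).
pose chr (l : seq ((H -> R) * (H -> R))) :=
  forall i, character (nth triv l i).1 (nth triv l i).2.
pose D := [set p : seq ((H -> R) * (H -> R)) * R | chr p.1 /\ 0 < p.2].
pose B (p : seq ((H -> R) * (H -> R)) * R) : set H :=
  [set z | ~ U z /\ forall i, 1 - p.2 < (nth triv p.1 i).1 z].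
have [[[l eta] [[/= chl eta0] Bl]]|noB] := pselect (exists p, D p /\ B p = set0).
  exists (size l), (fun j => (nth triv l j).1), (fun j => (nth triv l j).2), eta.
  split=> // z hz; apply: contrapT => Uz.
  have : B (l, eta) z; last by rewrite Bl.
  split => // i /=; have [il|il] := ltnP i (size l); first exact: (hz (Ordinal il)).
  by rewrite nth_default//= ltrBlDr ltrDl.
have D0 : D ([::], 1).
  by split => //= i; rewrite nth_nil; exact: character_trivial.
have FF : ProperFilter (filter_from D B).
  apply: filter_from_proper; last first.
    by move=> p Dp; apply/set0P/eqP => Bp; apply: noB; exists p.
  apply: filter_from_filter.
    by exists ([::], 1).
  move=> [l e] [l' e'] [/= chl e0] [/= chl' e0'].
  exists (l ++ l', Num.min e e').
    split; last by rewrite /= lt_min e0.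
    by move=> i /=; rewrite nth_cat; case: ifP => _; [exact: chl|exact: chl'].
  move=> z [Uz /= hz]; split; split=> // i /=.
    have [il|il] := ltnP i (size l).
      have := hz i; rewrite nth_cat il; apply: le_lt_trans.
      by rewrite lerB// ge_min lexx.
    by rewrite nth_default//= ltrBlDr ltrDl.
  have := hz (size l + i)%N; rewrite nth_cat ltnNge leq_addr /= addKn.
  by apply: le_lt_trans; rewrite lerB// ge_min lexx orbT.
have [z0 [_ cz]] := Hc FF (ltac:(by exists ([::], 1))).
have [z00|z00] := eqVneq z0 0.
  have [z [[Uz _] Uz']] := cz (B ([::], 1)) U
    (ltac:(by exists ([::], 1)))
    (ltac:(by rewrite z00)).
  by [].
have [c [s [ch cz0]]] := exists_character z00.
have cz1 : c z0 < 1 by rewrite lt_neqAle cz0 (character_le1 _ ch).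
pose e := (1 - c z0) / 2.
have e0 : 0 < e by rewrite divr_gt0// subr_gt0.
have De : D ([:: (c, s)], e).
  by split=> //= -[|i] //=; rewrite nth_nil; exact: character_trivial.
have nb : nbhs z0 [set z | c z < 1 - e].
  have [cc _ _ _ _] := ch.
  have : \forall z \near z0, `|c z0 - c z| < e.
    by have /cvgrPdist_lt/(_ _ e0) := cc z0.
  by apply: filterS => z /=; rewrite distrC ltr_distl /e => /andP[_]; lra.
have [z [[_ /(_ 0) /= h]]] := cz (B ([:: (c, s)], e)) _ (ltac:(by exists ([:: (c, s)], e))) nb.
by move=> /(lt_trans h); rewrite ltxx.
Qed.

End Separation.

Lemma connected_ind (G : topologicalType) (P : set G) (x0 : G) :
  connected [set: G] -> P x0 ->
  (forall x, \forall y \near x, P x <-> P y) -> forall x, P x.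
Proof.
move=> Gconn P0 Ploc.
have E : P = [set: G].
  apply: Gconn; first by exists x0.
    exists P; last by rewrite setTI.
    rewrite openE => x Px; apply: filterS (Ploc x) => y xy; exact/xy.
  exists P; last by rewrite setTI.
  rewrite -[P]setCK; apply: open_closedC; rewrite openE => x nPx.
  by apply: filterS (Ploc x) => y xy Py; apply: nPx; exact/xy.
by move=> x; rewrite E.
Qed.

(** * Angles of characters along a connected space *)

Section Angles.
Variables (R : realType) (H : topologicalZmodType).
Implicit Types c s : H -> R.

Definition angle c s (z : H) (a : R) := c z = cos a /\ s z = sin a.

Lemma angleD c s z z' a a' : character c s ->
  angle c s z a -> angle c s z' a' -> angle c s (z + z') (a + a').
Proof.
move=> [_ _ cD sD _] [e1 e2] [e3 e4]; split.
  by rewrite cD cosD e1 e2 e3 e4.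
by rewrite sD sinD e1 e2 e3 e4.
Qed.

Lemma angle0 c s : character c s -> angle c s 0 0.
Proof. by move=> /character0[c0 s0]; split; rewrite ?cos0 ?sin0. Qed.

Lemma angleN c s z a : character c s -> angle c s z a -> angle c s (- z) (- a).
Proof. by move=> /characterN[cN sN] [e1 e2]; split; rewrite ?cosN ?sinN ?cN ?sN ?e1 ?e2. Qed.

Lemma angleB c s z z' a a' : character c s ->
  angle c s z a -> angle c s z' a' -> angle c s (z - z') (a - a').
Proof. by move=> ch h /(angleN ch); exact: angleD. Qed.

Lemma near_seq (T : Type) (F : set_system T) (I : eqType) (r : seq I)
    (P : I -> T -> Prop) : Filter F ->
  (forall i, F (P i)) -> F (fun x => forall i, i \in r -> P i x).
Proof.
move=> FF FP; elim: r => [|i r IH]; first by apply: filterS filterT.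
by apply: filterS (filterI (FP i) IH) => x [Pi Pr] j; rewrite inE => /orP[/eqP ->|/Pr].
Qed.

Variables (G : topologicalType) (I : eqType) (c s : I -> H -> R).
Hypotheses (Gconn : connected [set: G]) (Hc : compact [set: H]).
Hypothesis ch : forall i, character (c i) (s i).
Variables (Phi : G -> H) (e : I -> G -> R) (x0 : G).
Hypotheses (ec : forall i, continuous (e i)) (e0 : forall i, e i x0 = 0).
Hypothesis Phie : forall i x, angle (c i) (s i) (Phi x) (e i x).

(** Connectedness joins x0 to x by a chain along which the angles e i change by
little, for the finitely many i in r. The increments of Phi along the chain have
these small angles; summing the increments of a suitable part of the chain gives
an element whose angles are close to the fraction t of the total. *)
Lemma approx_fractional_lift (r : seq I) (delta t : R) (x : G) :
  0 < delta -> 0 <= t <= 1 ->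
  exists z (a : I -> R), forall i, i \in r ->
    `|a i - t * e i x| <= delta /\ angle (c i) (s i) z (a i).
Proof.
move=> d0 t01.
pose del := delta / (size r).+1%:R.
have del0 : 0 < del by rewrite divr_gt0.
pose ok (p : H * (I -> R)) := forall i, i \in r -> `|p.2 i| <= del /\ angle (c i) (s i) p.1 (p.2 i).
pose p0 : H * (I -> R) := (0, fun=> 0).
have ok0 : ok p0 by move=> i _; split; [rewrite normr0 ltW|exact: angle0].
pose P x := exists l, (forall n, ok (nth p0 l n)) /\
  forall i, i \in r -> e i x = \sum_(p <- l) p.2 i.
have [l [lok lsum]] : P x.
  move: x; apply: (connected_ind Gconn (x0 := x0)).
    exists [::]; split; first by move=> n; rewrite nth_nil.
    by move=> i _; rewrite big_nil e0.
  have step u v : (forall i, i \in r -> `|e i u - e i v| <= del) -> P u -> P v.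
    move=> uv [l [lok lsum]].
    exists (rcons l (Phi v - Phi u, fun i => e i v - e i u)); split.
      move=> n; rewrite nth_rcons; case: ifP => _; first exact: lok.
      case: ifP => _; last exact: ok0.
      by move=> i ir /=; split; [rewrite distrC; exact: uv|exact: angleB].
    by move=> i ir; rewrite big_rcons /= -lsum// addrC subrK.
  move=> u; have : \forall v \near u, forall i, i \in r -> `|e i u - e i v| <= del.
    by apply: near_seq => i; have /cvgrPdist_le/(_ _ del0) := @ec i u.
  apply: filterS => v uv; split; first exact: step.
  by apply: step => i ir; rewrite distrC; exact: uv.
pose M : 'M[R]_(size l, size r) :=
  \matrix_(n, j) (nth p0 l n).2 (tnth (in_tuple r) j).
have [A hA] : exists A : {set 'I_(size l)}, forall j,
    `|\sum_(n in A) M n j - t * \sum_n M n j| <= (size r)%:R * del.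
  apply: rounding => //; first exact: ltW.
  by move=> n j; rewrite mxE; have [] := lok n (tnth (in_tuple r) j) (mem_tnth _ _).
exists (\sum_(n in A) (nth p0 l n).1), (fun i => \sum_(n in A) (nth p0 l n).2 i).
move=> i ir; split.
  have /tnthP[j ij] : i \in in_tuple r by [].
  have := hA j; under eq_bigr do rewrite mxE; under [X in _ - _ * X]eq_bigr do rewrite mxE.
  rewrite -ij lsum// (big_nth p0) big_mkord => /le_trans; apply.
  rewrite /del mulrCA ler_piMr ?(ltW d0)// ler_pdivrMr// mul1r ler_nat.
  exact: leqnSn.
apply: (big_ind2 (fun z a => angle (c i) (s i) z a)).
- exact: angle0.
- by move=> *; exact: angleD.
- by move=> n _; have [] := lok n i ir.
Qed.

(** Approximate solutions for finitely many characters exist, and H is compact. The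
elements z, for varying t, replace the one-parameter subgroup through Phi x that a Lie
algebra of H would provide. *)
Lemma fractional_lift (t : R) (x : G) : 0 <= t <= 1 ->
  exists z, forall i, angle (c i) (s i) z (t * e i x).
Proof.
move=> t01.
pose D := [set p : seq I * R | 0 < p.2].
pose B (p : seq I * R) : set H := [set z | exists a : I -> R, forall i, i \in p.1 ->
    `|a i - t * e i x| <= p.2 /\ angle (c i) (s i) z (a i)].
have FF : ProperFilter (filter_from D B).
  apply: filter_from_proper; last first.
    by move=> [r d] /= d0; exact: approx_fractional_lift.
  apply: filter_from_filter; first by exists ([::], 1) => //; rewrite /D /= ltr01.
  move=> [r d] [r' d'] /= d0 d'0; exists (r ++ r', Num.min d d').
    by rewrite /D /= lt_min d0.
  move=> z [a ha]; split; exists a => i /= ir.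
    have [|h1 h2] := ha i; first by rewrite mem_cat ir.
    by split => //; apply: le_trans h1 _; rewrite ge_min lexx.
  have [|h1 h2] := ha i; first by rewrite mem_cat ir orbT.
  by split => //; apply: le_trans h1 _; rewrite ge_min lexx orbT.
have [z [_ cz]] := Hc FF (ltac:(by exists ([::], 1) => //; rewrite /D /= ltr01)).
exists z => i; have [cc sc _ _ _] := ch i.
have lim (g : H -> R) (tr : R -> R) : continuous g -> continuous tr ->
    (forall z a, angle (c i) (s i) z a -> g z = tr a) -> g z = tr (t * e i x).
  move=> gc trc gtr; apply: (@eq_of_dist _ _ _ 2) => eps eps0.
  have /cvgrPdist_le/(_ _ eps0) gz := gc z.
  have /cvgrPdist_le/(_ _ eps0) := trc (t * e i x).
  move=> /nbhs_ballP[d d0 hd]; have d20 : 0 < d / 2 by rewrite divr_gt0.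
  have [z' [[a /(_ i)]]] := cz (B ([:: i], d / 2)) _
    (ltac:(by exists ([:: i], d / 2))) gz.
  rewrite inE eqxx => /(_ isT)[ad /gtr gz'] /= zz'.
  have : `|tr (t * e i x) - tr (a i)| <= eps.
    by apply: hd; rewrite /ball /= distrC (le_lt_trans ad)//= ltr_pdivrMr// mulr2n mulrDr mulr1 ltrDl.
  move: zz'; rewrite gz' !ler_distl => /andP[? ?] /andP[? ?].
  by apply/andP; split; lra.
split; first by apply: lim => //; [exact: continuous_cos|move=> ? ? []].
by apply: lim => //; [exact: continuous_sin|move=> ? ? []].
Qed.

End Angles.

Section Lift.
Variables (R : realType) (G H : topologicalZmodType).
Hypotheses (Gc : compact [set: G]) (Gconn : connected [set: G]).
Variables (c s : H -> R) (f : G -> H).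
Hypotheses (ch : character c s) (fc : continuous f).

Lemma angle_asin z : 0 < c z -> -1 < s z < 1 /\ angle c s z (asin (s z)).
Proof.
move=> cz; have [_ _ _ _ /(_ z) cs] := ch.
have b : -1 < s z < 1 by apply/andP; split; nra.
have b' : -1 <= s z <= 1 by case/andP: b => *; apply/andP; split; exact: ltW.
split => //; split; last by rewrite asinK// in_itv.
rewrite cos_asin//; have -> : 1 - s z ^+ 2 = c z ^+ 2 by rewrite -cs addrK.
by rewrite sqrtr_sqr gtr0_norm.
Qed.

Let Q (C : R) (y : G) := exists L : G -> R, [/\ continuous L,
  forall x, `|L x| <= C & forall x, angle c s (f (x + y) - f x) (L x)].

Let W : set G := [set v | forall x, 0 < c (f (x + v) - f x)].

Let continuousDr (y : G) : continuous (fun x : G => x + y).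
Proof.
move=> x; apply: (@continuous_comp _ _ _ (fun x => (x, y)) (fun p : G * G => p.1 + p.2)).
  by apply: cvg_pair; [exact: cvg_id|exact: cvg_cst].
exact: add_continuous.
Qed.

Let continuous_diff : continuous (fun p : G * G => f (p.1 + p.2) - f p.1).
Proof.
move=> p; apply: (@continuous_comp _ _ _ (fun p : G * G => (f (p.1 + p.2), f p.1))
  (fun q : H * H => q.1 - q.2)); last exact: sub_continuous.
apply: cvg_pair => /=; apply: continuous_comp; [|exact: fc| |exact: fc].
  exact: add_continuous.
exact: cvg_fst.
Qed.

Let W_nbhs : nbhs (0 : G) W.
Proof.
have [cc _ _ _ _] := ch; have [c0 _] := character0 ch.
pose P (v x : G) := 0 < c (f (x + v) - f x).
have : \forall v \near (0 : G), [set: G] `<=` P v.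
  apply: (iffLR (compact_near_coveringP _) Gc _ _ P) => x _.
  have cont : continuous (fun p : G * G => c (f (p.1 + p.2) - f p.1)).
    move=> p; apply: (@continuous_comp _ _ _ (fun p : G * G => f (p.1 + p.2) - f p.1) c).
      exact: continuous_diff.
    exact: cc.
  have /cvgrPdist_lt/(_ _ ltr01) := cont (x, 0).
  rewrite /= addr0 subrr c0.
  apply: filterS => -[x' v] /=; rewrite ltr_distl /P => /andP[_]; lra.
by apply: filterS => v h x; exact: h.
Qed.

Let Q_step C y v : Q C y -> W v -> Q (C + pi / 2) (y + v).
Proof.
move=> [L [Lc Lb La]] Wv; have [_ sc _ _ _] := ch.
exists (fun x => L x + asin (s (f (x + y + v) - f (x + y)))).
have Wx x := angle_asin (Wv (x + y)).
split.
- move=> x; apply: cvgD; first exact: Lc.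
  apply: (@continuous_comp _ _ _ (fun x => s (f (x + y + v) - f (x + y))) (@asin R)).
    apply: (@continuous_comp _ _ _ (fun x => f (x + y + v) - f (x + y)) s); last exact: sc.
    apply: (@continuous_comp _ _ _ (fun x : G => (x + y, v))
      (fun p : G * G => f (p.1 + p.2) - f p.1)); last exact: continuous_diff.
    by apply: cvg_pair; [exact: continuousDr|exact: cvg_cst].
  by apply: continuous_asin; have [] := Wx x.
- move=> x; apply: le_trans (ler_normD _ _) _; apply: lerD => //.
  have [/andP[s1 s2] _] := Wx x.
  by rewrite ler_norml asin_geNpi2 ?asin_lepi2// !ltW.
- move=> x; have -> : f (x + (y + v)) - f x =
      (f (x + y) - f x) + (f (x + y + v) - f (x + y)).
    by rewrite addrA [RHS]addrC subrKA.
  by apply: angleD => //; have [] := Wx x.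
Qed.

(** Every difference of f along a translation has a continuous angle: it is a
sum of boundedly many differences along small translations, for which the
arcsine provides one. The bound is uniform in y because G is compact. *)
Lemma difference_lift : exists C : R, forall y, exists L : G -> R, [/\ continuous L,
  forall x, `|L x| <= C & forall x, angle c s (f (x + y) - f x) (L x)].
Proof.
have ex y : exists C, Q C y.
  move: y; apply: (connected_ind Gconn (x0 := 0)).
    exists 0, (fun=> 0); split; first by move=> x; exact: cvg_cst.
      by move=> x; rewrite normr0.
    by move=> x; rewrite addr0 subrr; exact: angle0.
  move=> y.
  apply: filterS (filterI (nbhs_subr y W_nbhs) (nbhs_sub_left y W_nbhs)) => y' /= [w1 w2]; split=> -[C QC]; exists (C + pi / 2).
    by rewrite -(subrKC y y'); exact: (Q_step QC w1).
  by rewrite -(subrKC y' y); exact: (Q_step QC w2).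
have [C hC] := choice ex.
have W'_nbhs : nbhs (0 : G) [set v | W (- v)].
  by apply: (@opp_continuous G 0 W); rewrite oppr0.
have [r net] := compact_net Gc W'_nbhs.
exists (\sum_(y <- r) `|C y| + pi / 2) => y.
have [y' yr /= Wy] := net y; rewrite opprB in Wy.
have [L [Lc Lb La]] := Q_step (hC y') Wy; rewrite subrKC in La.
exists L; split=> // x; apply: le_trans (Lb x) _; rewrite lerD2r.
rewrite (perm_big _ (perm_to_rem yr)) big_cons.
by apply: le_trans (ler_norm _) _; rewrite lerDl sumr_ge0.
Qed.

End Lift.

(** * Rigidity of equivariant maps *)

Lemma cos_eq1 (R : realType) (a : R) : `|a| <= pi -> cos a = 1 -> a = 0.
Proof.
move=> api ca; apply/eqP; rewrite -normr_eq0; apply/eqP.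
apply: (@cos_inj R); rewrite ?in_itv /= ?normr_ge0 ?api ?lexx ?pi_ge0//.
by rewrite cos0 -ca; case: (ler0P a) => _; rewrite ?cosN.
Qed.

Section Rigidity.
Variables (R : realType) (Gamma : discreteGroupType) (G H : topologicalZmodType).
Hypotheses (Gc : compact [set: G]) (Gconn : connected [set: G]).
Hypotheses (Hc : compact [set: H]) (Hconn : connected [set: H]).
Hypothesis Hm : metrizable R H.
Variables (rho : Gamma -> G -> G) (sigma : Gamma -> H -> H).
Hypotheses (rho_affine : forall g, affine_map (rho g)).
Hypotheses (sigma_affine : forall g, affine_map (sigma g)).
Hypothesis sigma_expansive : expansive sigma.
Variable f : G -> H.
Hypotheses (f_equivariant : equivariant rho sigma f) (fc : continuous f).

(** Let D be the second difference, as a function of x. Its images under the linear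
parts of sigma are second differences of f at other points, so their character values
have continuous angles e with e 0 = 0 which are bounded uniformly in the group element.
Rescaling these angles by a small t gives a point z of H all of whose images lie in the
expansivity neighbourhood. Hence z = 0, so the small angles t * e are 0. Then
the images of D lie in that neighbourhood as well, and D = 0 for the same reason. *)
Lemma second_difference_eq0 x y : f (x + y) - f x - (f y - f 0) = 0.
Proof.
have [U U0 Uexp] := sigma_expansive.
have /choice[bA hA] : forall g, exists p : G * {additive G -> G},
    continuous p.2 /\ forall x, rho g x = p.1 + p.2 x.
  by move=> g; have [b [A [Ac hA]]] := rho_affine g; exists (b, A).
pose b g := (bA g).1; pose A g := (bA g).2.
have Ac g : continuous (A g) by case: (hA g).
have rhoE g z : rho g z = b g + A g z by case: (hA g).
have /choice[bB hB] : forall g, exists p : H * {additive H -> H},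
    continuous p.2 /\ forall x, sigma g x = p.1 + p.2 x.
  by move=> g; have [b' [B [Bc hB]]] := sigma_affine g; exists (b', B).
pose B g := (bB g).2.
have Bc g : continuous (B g) by case: (hB g).
have sigmaB g u v : sigma g u - sigma g v = B g (u - v).
  by case: (hB g) => _ hs; rewrite !hs raddfB opprD addrACA subrr add0r.
have Bf g u v : B g (f u - f v) = f (b g + A g u) - f (b g + A g v).
  rewrite -sigmaB -!rhoE; have h w : f (rho g w) = sigma g (f w).
    by have /(congr1 (fun F => F w)) := f_equivariant g.
  by rewrite !h.
have zero u : (forall g, U (B g u)) -> u = 0.
  move=> Uu; apply: contrapT => u0; have [g] := Uexp u 0 u0.
  by apply; rewrite sigmaB subr0.
have [m [c [s [eta [eta0 ch chU]]]]] := finite_characters Hc Hconn Hm U0.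
have /choice[C hC] : forall j, exists C : R, forall y, exists L : G -> R, [/\ continuous L,
    forall x, `|L x| <= C & forall x, angle (c j) (s j) (f (x + y) - f x) (L x)].
  by move=> j; exact: difference_lift.
pose I := ('I_m * Gamma)%type.
have /choice[L hL] : forall i : I, exists L : G -> R, [/\ continuous L,
    forall x, `|L x| <= C i.1 &
    forall x, angle (c i.1) (s i.1) (f (x + A i.2 y) - f x) (L x)].
  by move=> i; exact: hC.
pose c' (i : I) := c i.1 \o B i.2; pose s' (i : I) := s i.1 \o B i.2.
have ch' i : character (c' i) (s' i) by apply: character_comp.
pose Phi z := f (z + y) - f z - (f y - f 0).
pose e (i : I) z := L i (b i.2 + A i.2 z) - L i (b i.2).
have ec i : continuous (e i).
  have [Lc _ _] := hL i; move=> z; apply: cvgB; last exact: cvg_cst.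
  apply: (@continuous_comp _ _ _ (fun z => b i.2 + A i.2 z) (L i)); last exact: Lc.
  apply: (@continuous_comp _ _ _ (fun z => (b i.2, A i.2 z)) (fun p : G * G => p.1 + p.2)).
    by apply: cvg_pair; [exact: cvg_cst|exact: Ac].
  exact: add_continuous.
have e0 i : e i 0 = 0 by rewrite /e raddf0 addr0 subrr.
have Phie i z : angle (c' i) (s' i) (Phi z) (e i z).
  have [_ _ La] := hL i.
  have : angle (c i.1) (s i.1) (B i.2 (Phi z)) (e i z).
    have -> : B i.2 (Phi z) = (f (b i.2 + A i.2 z + A i.2 y) - f (b i.2 + A i.2 z))
        - (f (b i.2 + A i.2 y) - f (b i.2)).
      by rewrite /Phi raddfB !Bf raddfD raddf0 addr0 addrA.
    exact: angleB.
  by [].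
pose K : R := 1 + 2 * \sum_j `|C j|.
have K1 : 1 <= K by rewrite /K lerDl mulr_ge0// sumr_ge0.
have eK i z : `|e i z| <= K.
  have [_ Lb _] := hL i; apply: le_trans (ler_normB _ _) _.
  have Cle : C i.1 <= \sum_j `|C j|.
    rewrite (bigD1 i.1)//=; apply: le_trans (ler_norm _) _.
    by rewrite lerDl sumr_ge0.
  have := Lb (b i.2 + A i.2 z); have := Lb (b i.2); rewrite /K; lra.
have [r r0 hr] : exists2 r : R, 0 < r & forall a, `|a| < r -> 1 - eta < cos a.
  have /cvgrPdist_lt/(_ _ eta0)/nbhs_ballP[r r0 hr] := @continuous_cos R 0.
  exists r => // a ar; have := hr a; rewrite /ball /= sub0r normrN cos0 => /(_ ar).
  by rewrite distrC ltr_distl => /andP[].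
(* small enough for all the angles t * e to be below r, where cosine exceeds 1 - eta,
   and below 1 < pi, where cosine takes the value 1 only at 0 *)
pose t := Num.min r 1 / (2 * K).
have K20 : 0 < 2 * K by lra.
have m0 : 0 < Num.min r 1 by rewrite lt_min r0 ltr01.
have t0 : 0 < t by rewrite divr_gt0.
have m1 : Num.min r 1 <= 1 by rewrite ge_min lexx orbT.
have t1 : t <= 1 by rewrite ler_pdivrMr// mul1r; lra.
have te i z : `|t * e i z| < Num.min r 1.
  rewrite normrM gtr0_norm//; apply: le_lt_trans (_ : t * K < _).
    by rewrite ler_wpM2l// ltW.
  by rewrite /t mulrAC ltr_pdivrMr// ltr_pM2l//; lra.
have t01 : 0 <= t <= 1 by rewrite (ltW t0) t1.
have [z hz] := fractional_lift Gconn Hc ch' ec e0 Phie x t01.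
have z0 : z = 0.
  apply: zero => g; apply: chU => j; have [cz _] := hz (j, g).
  rewrite [c j _]cz; apply: hr; apply: lt_le_trans (te _ _) _.
  by rewrite ge_min lexx.
apply: zero => g; apply: chU => j.
have [cz _] := hz (j, g); have [c0 _] := character0 (ch' (j, g)).
have te0 : t * e (j, g) x = 0.
  apply: cos_eq1; last by rewrite -cz z0.
  apply: ltW; apply: lt_le_trans (te _ _) _; apply: le_trans m1 _.
  by apply: le_trans (pi_ge2 R); rewrite ler1n.
have [cD _] := Phie (j, g) x.
rewrite [c j _]cD; move/eqP: te0; rewrite mulf_eq0 (gt_eqF t0) /= => /eqP ->.
by rewrite cos0 ltrBlDr ltrDl.
Qed.

End Rigidity.

Theorem corollary1 (R : realType) (Gamma : discreteGroupType)
    (G H : topologicalZmodType)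
    (G_compact : compact [set: G]) (G_connected : connected [set: G])
    (G_metrizable : metrizable R G)
    (H_compact : compact [set: H]) (H_connected : connected [set: H])
    (H_metrizable : metrizable R H)
    (rho : Gamma -> G -> G) (sigma : Gamma -> H -> H)
    (rho_affine : affine_action rho) (sigma_affine : affine_action sigma)
    (sigma_expansive : expansive sigma)
    (f : G -> H) (f_equivariant : equivariant rho sigma f)
    (f_continuous : continuous f) :
  affine_map f.
Proof.
have f2 := second_difference_eq0 G_compact G_connected H_compact H_connected
  H_metrizable rho_affine.2 sigma_affine.2 sigma_expansive f_equivariant f_continuous.
pose theta x := f x - f 0.
have thetaB : zmod_morphism theta.
  move=> x y; rewrite /theta; have /eqP := f2 (x - y) y.
  by rewrite subrK subr_eq0 => /eqP <-; rewrite opprB [RHS]addrC subrKA.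
pose th : {additive G -> H} := HB.pack theta (GRing.isZmodMorphism.Build G H theta thetaB).
exists (f 0), th; split; last by move=> x; rewrite /= /theta subrKC.
move=> x; apply: (@continuous_comp _ _ _ (fun x => (f x, f 0))
  (fun p : H * H => (p.1 - p.2))); last exact: sub_continuous.
by apply: cvg_pair; [exact: f_continuous|exact: cvg_cst].
Qed.
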